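(* Let $I$ be a non-empty set and let $E\subseteq\mathbb{R}^I$ be a linear subspace containing all $e_i$ ($i\in I$), endowed with a complete absolute normalised norm $\|\cdot\|_E$ such that $\operatorname{span}\{e_i:i\in I\}$ is dense in $E$. If $(X_i)_{i\in I}$ is a family of wuacs (resp. $\mathrm{luacs}^+$) Banach spaces and if $E$ is wuacs (resp. $\mathrm{luacs}^+$) and does not contain an isomorphic copy of $\ell^1$, then $\bigl[\bigoplus_{i\in I}X_i\bigr]_E$ is also wuacs (resp. $\mathrm{luacs}^+$).
   Context: Banach spaces are real; $S_X$ denotes the unit sphere of $X$ and $X^*$ its dual. A Banach space $X$ is called - wuacs if for any two sequences $(x_n)$, $(y_n)$ in $S_X$ and every $x^*\in S_{X^*}$: $\|x_n+y_n\|\to 2$ and $x^*(x_n)\to 1$ imply $x^*(y_n)\to 1$; - $\mathrm{luacs}^+$ if for every $x\in S_X$, every sequence $(x_n)$ in $S_X$ with $\|x_n+x\|\to 2$ and all $x^*\in S_{X^*}$: $x^*(x_n)\to 1\iff x^*(x)=1$. For a non-empty set $I$, $e_i\in\mathbb{R}^I$ denotes the characteristic function of $\{i\}$. A norm $\|\cdot\|_E$ on a subspace $E$ of $\mathbb{R}^I$ (with all $e_i\in E$) is absolute if whenever $(a_i)_{i\in I}\in E$, $(b_i)_{i\in I}\in\mathbb{R}^I$ and $|a_i|=|b_i|$ for all $i\in I$, then $(b_i)_{i\in I}\in E$ and $\|(a_i)_{i\in I}\|_E=\|(b_i)_{i\in I}\|_E$; it is normalised if $\|e_i\|_E=1$ for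 every $i\in I$. For a family $(X_i)_{i\in I}$ of Banach spaces, the absolute sum with respect to $E$ is $\bigl[\bigoplus_{i\in I}X_i\bigr]_E=\{(x_i)_{i\in I}\in\prod_{i\in I}X_i:(\|x_i\|)_{i\in I}\in E\}$ with the norm $\|(x_i)_{i\in I}\|_E=\|(\|x_i\|)_{i\in I}\|_E$; it is a Banach space. *)

(* Defs.v *)
From HB Require Import structures.
From mathcomp Require Import all_boot all_order all_algebra.
From mathcomp Require Import all_classical all_reals all_analysis.
From mathcomp Require Import ring lra.

Set Implicit Arguments.
Unset Strict Implicit.
Unset Printing Implicit Defensive.

Import Order.TTheory GRing.Theory Num.Theory.
Import numFieldNormedType.Exports.

Local Open Scope classical_set_scope.
Local Open Scope ring_scope.

(* Linear subspaces of an ambient vector space carrying their own norm.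
   The norm is given as a function on the whole ambient space, but only its
   values on the carrier are constrained and used. *)
Record normed_subspace (R : realType) (V : lmodType R) := NormedSubspace {
  ns_carrier : set V ;
  ns_norm : V -> R ;
  ns_0 : ns_carrier 0 ;
  ns_linear : forall (c : R) (x y : V),
    ns_carrier x -> ns_carrier y -> ns_carrier (c *: x + y) ;
  ns_normD : forall x y : V, ns_carrier x -> ns_carrier y ->
    ns_norm (x + y) <= ns_norm x + ns_norm y ;
  ns_normZ : forall (c : R) (x : V), ns_carrier x ->
    ns_norm (c *: x) = `|c| * ns_norm x ;
  ns_norm0_eq0 : forall x : V, ns_carrier x -> ns_norm x = 0 -> x = 0 }.

Section ns_type.
Context (R : realType) (V : lmodType R) (S : normed_subspace V).

Definition ns_pred : {pred V} := mem (ns_carrier S).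

Lemma ns_submod_closed : submod_closed ns_pred.
Proof.
split; first by apply/mem_set; exact: ns_0.
by move=> c x y /set_mem Sx /set_mem Sy; apply/mem_set; exact: ns_linear.
Qed.

HB.instance Definition _ := GRing.isSubmodClosed.Build R V ns_pred
  ns_submod_closed.

Record ns_type := NsType { ns_val : V ; ns_valP : ns_val \in ns_pred }.

HB.instance Definition _ := [isSub for ns_val].
HB.instance Definition _ := [Choice of ns_type by <:].
HB.instance Definition _ := [SubChoice_isSubLmodule of ns_type by <:].

Lemma ns_valS (x : ns_type) : ns_carrier S (ns_val x).
Proof. exact: set_mem (ns_valP x). Qed.

Definition ns_mk (v : V) (Sv : ns_carrier S v) : ns_type :=
  NsType (mem_set Sv : v \in ns_pred).

Let nrm (x : ns_type) := ns_norm S (ns_val x).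

Let nrmD x y : nrm (x + y) <= nrm x + nrm y.
Proof. by apply: ns_normD; exact: ns_valS. Qed.

Let nrmZ (c : R) x : nrm (c *: x) = `|c| * nrm x.
Proof. by apply: ns_normZ; exact: ns_valS. Qed.

Let nrm0 x : nrm x = 0 -> x = 0.
Proof. by move=> x0; apply/val_inj/(ns_norm0_eq0 (ns_valS x) x0). Qed.

HB.instance Definition _ := Lmodule_isNormed.Build R ns_type nrmD nrmZ nrm0.

Lemma ns_normE (x : ns_type) : `|x| = ns_norm S (ns_val x).
Proof. by []. Qed.

End ns_type.

Coercion ns_type : normed_subspace >-> Sortclass.

(* A linear subspace E of R^I containing all e_i = \1_[set i], with a complete
   absolute normalised norm. *)
Record absolute_space (R : realType) (I : Type) := AbsoluteSpace {
  as_space : normed_subspace (I -> R^o) ;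
  as_unit : forall i : I, ns_carrier as_space \1_[set i] ;
  as_complete : forall F : set_system as_space,
    ProperFilter F -> cauchy F -> cvg F ;
  as_absolute : forall a b : I -> R^o, ns_carrier as_space a ->
    (forall i, `|a i| = `|b i|) ->
    ns_carrier as_space b /\ ns_norm as_space a = ns_norm as_space b ;
  as_normalised : forall i : I, ns_norm as_space \1_[set i] = 1 }.

Definition as_type (R : realType) (I : Type) (E : absolute_space R I) : Type :=
  ns_type (as_space E).

Coercion as_type : absolute_space >-> Sortclass.

Section absolute_space_theory.
Context (R : realType) (I : Type) (E : absolute_space R I).

HB.instance Definition _ := NormedModule.on (as_type E).
HB.instance Definition _ := Uniform_isComplete.Build (as_type E)
  (@as_complete R I E).

Definition as_e (i : I) : E := ns_mk (as_unit E i).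

Let C := ns_carrier (as_space E).
Let N := ns_norm (as_space E).

Lemma as_norm_ge0 (a : I -> R^o) : C a -> 0 <= N a.
Proof. by move=> Ca; rewrite -[N a]/(`|ns_mk Ca : E|). Qed.

Lemma as_coord_le (a : I -> R^o) (i : I) : C a -> `|a i| <= N a.
Proof.
move=> Ca.
pose b : I -> R^o := fun j => if `[< j = i >] then a j else - a j.
have [Cb Nb] : C b /\ N a = N b.
  apply: as_absolute => // j; rewrite /b.
  by case: ifP => // _; rewrite normrN.
have ab : a + b = (2 * a i) *: (\1_[set i] : I -> R^o).
  apply/funext => j.
  suff : (a j : R) + b j = 2 * (a i : R) * \1_[set i] j by [].
  rewrite /b indicE.
  case: asboolP => [->|ji]; first by rewrite mem_set// mulr1 mulr_natl mulr2n.
  by rewrite memNset// mulr0 subrr.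
have := ns_normD Ca Cb; rewrite ab ns_normZ; last exact: as_unit.
rewrite as_normalised mulr1 -/N -Nb normrM ger0_norm//.
have -> : N a + N a = 2 * N a by rewrite mulr_natl mulr2n.
by rewrite ler_pM2l.
Qed.

Lemma as_cvg_coord (F : set_system E) {FF : Filter F} (u : E) (i : I) :
  F --> u -> ns_val x i @[x --> F] --> ns_val u i.
Proof.
move=> /cvgrPdist_lt Fu; apply/cvgrPdist_lt => e e0.
near=> x.
apply: (@le_lt_trans _ _ `|u - x|); last by near: x; exact: Fu.
exact: (as_coord_le i (ns_valS (u - x : ns_type _))).
Unshelve. all: by end_near. Qed.

(* the partial sums of the signed binary expansion of t \in [-1, 1] *)
Let rem (t : R) : nat -> R := fix r n :=
  if n is m.+1 then 2 * r m - (if 0 <= r m then 1 else -1) else t.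
Let sgn (t : R) n : R := if 0 <= rem t n then 1 else -1.

Let rem_le1 t n : `|t| <= 1 -> `|rem t n| <= 1.
Proof.
move=> t1; elim: n => //= n; rewrite !ler_norml => /andP[r1 r2].
by case: ifPn; rewrite -?ltNge => r0; apply/andP; split; lra.
Qed.

Let rem_sum t n :
  t = \sum_(k < n) 2^-1 ^+ k.+1 * sgn t k + 2^-1 ^+ n * rem t n.
Proof.
elim: n => [|n IH]; first by rewrite big_ord0 add0r expr0 mul1r.
rewrite big_ord_recr/= {1}IH /sgn exprS.
set x := 2^-1 ^+ n; set r := rem t n; set s := (if _ then _ else _).
by field.
Qed.

Lemma as_mono (a b : I -> R^o) : C b -> (forall i, `|a i| <= `|b i|) ->
  C a /\ N a <= N b.
Proof.
move=> Cb ab.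
pose t i : R := a i / b i.
have t1 i : `|t i| <= 1.
  rewrite /t; have [b0|b0] := eqVneq (b i) 0; first by rewrite b0 invr0 mulr0 normr0.
  by rewrite normf_div ler_pdivrMr ?normr_gt0// mul1r.
have tb i : t i * b i = a i.
  rewrite /t; have [b0|b0] := eqVneq (b i) 0; last by rewrite divfK.
  by have := ab i; rewrite b0 normr0 mulr0 normr_le0 => /eqP ->.
pose s k : I -> R^o := fun i => sgn (t i) k * b i.
have [Cs Ns] : (forall k, C (s k)) /\ (forall k, N (s k) = N b).
  have H k : C (s k) /\ N b = N (s k).
    apply: as_absolute => // i; rewrite /s normrM /sgn.
    by case: ifP; rewrite ?normrN normr1 mul1r.
  by split=> k; case: (H k).
pose u k : E := 2^-1 ^+ k.+1 *: (ns_mk (Cs k) : E).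
have nu k : `|u k| = 2^-1 ^+ k.+1 * N b.
  by rewrite normrZ -[`|ns_mk _ : E|]/(N (s k)) Ns ger0_norm.
have gE : (fun k => `|u k|) = geometric (N b / 2) 2^-1.
  by apply/funext => k; rewrite nu /= exprS; ring.
have h1 : `|2^-1 : R| < 1 by rewrite ger0_norm// invf_lt1// ltr1n.
have cu : cvgn [normed series u].
  by rewrite /normed_series_of gE; exact: is_cvg_geometric_series.
have := normed_cvg cu => /cvg_ex[/= l ul].
have la : ns_val l = a.
  apply/funext => i.
  have eq : (fun n => ns_val (series u n) i) =
            (fun n => a i - 2^-1 ^+ n * rem (t i) n * b i).
    apply/funext => n.
    have -> : ns_val (series u n) i
        = \sum_(k < n) 2^-1 ^+ k.+1 * sgn (t i) k * b i.
      rewrite /series/= big_mkord; elim: n => [|n IH]; first by rewrite !big_ord0.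
      rewrite !big_ord_recr/= -IH.
      by rewrite -mulrA.
    by rewrite -tb {2}(rem_sum (t i) n) -mulr_suml; ring.
  have c1 : (fun n => ns_val (series u n) i : R) @ \oo --> (ns_val l i : R).
    have FF : Filter (series u @ \oo) by exact: fmap_filter.
    exact: (@as_cvg_coord (series u @ \oo) FF l i ul).
  have c2 : (fun n => 2^-1 ^+ n * rem (t i) n : R) @ \oo --> (0 : R).
    apply/norm_cvg0P.
    apply: (@squeeze_cvgr _ _ _ _ (cst 0) (GRing.exp 2^-1)).
    - apply: nearW => n; rewrite normr_ge0/= normrM ger0_norm//.
      by rewrite ler_piMr// rem_le1.
    - exact: cvg_cst.
    - exact: cvg_expr.
  have c3 : (fun n => ns_val (series u n) i : R) @ \oo --> (a i : R).
    rewrite eq -[X in _ --> X]subr0; apply: cvgB; first exact: cvg_cst.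
    by rewrite -[0](mul0r (b i : R)); exact: (cvgMr_tmp (b := b i) c2).
  by rewrite -(cvg_lim (@norm_hausdorff _ _) c1) (cvg_lim (@norm_hausdorff _ _) c3).
split; first by rewrite -la; exact: ns_valS.
rewrite -la -[N _]/(`|l|) -(cvg_lim _ ul)//.
apply: (le_trans (lim_series_norm cu)).
rewrite /normed_series_of gE (cvg_lim _ (@cvg_geometric_series R (N b / 2) 2^-1 h1))//.
by rewrite le_eqVlt; apply/orP; left; apply/eqP; field.
Qed.

End absolute_space_theory.

Section family_prod.
Context (R : realType) (I : Type) (X : I -> completeNormedModType R).

Definition family_prod : Type := forall i : I, X i.

HB.instance Definition _ := gen_eqMixin family_prod.
HB.instance Definition _ := gen_choiceMixin family_prod.

Let fp_ext (x y : family_prod) : (forall i, x i = y i) -> x = y.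
Proof. exact: functional_extensionality_dep. Qed.

Let add (x y : family_prod) : family_prod := fun i => x i + y i.
Let opp (x : family_prod) : family_prod := fun i => - x i.
Let zero : family_prod := fun i => 0.
Let scale (c : R) (x : family_prod) : family_prod := fun i => c *: x i.

Let addA : associative add.
Proof. by move=> x y z; apply: fp_ext => i; exact: addrA. Qed.
Let addC : commutative add.
Proof. by move=> x y; apply: fp_ext => i; exact: addrC. Qed.
Let add0 : left_id zero add.
Proof. by move=> x; apply: fp_ext => i; exact: add0r. Qed.
Let addN : left_inverse zero opp add.
Proof. by move=> x; apply: fp_ext => i; exact: addNr. Qed.

HB.instance Definition _ :=
  GRing.isZmodule.Build family_prod addA addC add0 addN.

Let scaleA a b x : scale a (scale b x) = scale (a * b) x.
Proof. by apply: fp_ext => i; exact: scalerA. Qed.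
Let scale1 : left_id 1 scale.
Proof. by move=> x; apply: fp_ext => i; exact: scale1r. Qed.
Let scaleDr : right_distributive scale +%R.
Proof. by move=> a x y; apply: fp_ext => i; exact: scalerDr. Qed.
Let scaleDl x : {morph scale^~ x : a b / a + b}.
Proof. by move=> a b; apply: fp_ext => i; exact: scalerDl. Qed.

HB.instance Definition _ := GRing.Zmodule_isLmodule.Build R family_prod
  scaleA scale1 scaleDr scaleDl.

End family_prod.

(* The absolute sum of the X i with respect to E: the families x such that
   (`|x i|)_i lies in E, normed by the E-norm of (`|x i|)_i. *)
Section absolute_sum.
Context (R : realType) (I : Type) (E : absolute_space R I).
Context (X : I -> completeNormedModType R).
Local Notation P := (family_prod X).

Definition norm_family (x : P) : I -> R^o := fun i => `|x i|.

Let C : set P := [set x | ns_carrier (as_space E) (norm_family x)].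
Let N (x : P) : R := ns_norm (as_space E) (norm_family x).

Let C0 : C 0.
Proof.
rewrite /C/= (_ : norm_family 0 = 0); first exact: ns_0.
by apply/funext => i; exact: normr0.
Qed.

Let nfZ c x : norm_family (c *: x) = `|c| *: norm_family x.
Proof. by apply/funext => i; exact: normrZ. Qed.

Let CD_sub x y : C x -> C y ->
  ns_carrier (as_space E) (norm_family x + norm_family y).
Proof. by move=> Cx Cy; rewrite -[norm_family x]scale1r; exact: ns_linear. Qed.

Let nfD x y i :
  `|norm_family (x + y) i| <= `|(norm_family x + norm_family y) i|.
Proof.
rewrite /norm_family normr_id ger0_norm; last exact: addr_ge0.
exact: ler_normD.
Qed.

Let CZ c x : C x -> C (c *: x).
Proof.
by move=> Cx; rewrite /C/= nfZ -[_ *: _]addr0; apply: ns_linear => //; exact: ns_0.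
Qed.

Let CD x y : C x -> C y -> C (x + y).
Proof. by move=> Cx Cy; have [] := as_mono (CD_sub Cx Cy) (nfD x y). Qed.

Let C_linear (c : R) x y : C x -> C y -> C (c *: x + y).
Proof. by move=> Cx Cy; apply: CD => //; exact: CZ. Qed.

Let ND x y : C x -> C y -> N (x + y) <= N x + N y.
Proof.
move=> Cx Cy; have [_ h] := as_mono (CD_sub Cx Cy) (nfD x y).
by apply: (le_trans h); exact: ns_normD.
Qed.

Let NZ (c : R) x : C x -> N (c *: x) = `|c| * N x.
Proof. by move=> Cx; rewrite /N nfZ ns_normZ// normr_id. Qed.

Let N0 x : C x -> N x = 0 -> x = 0.
Proof.
move=> Cx /(ns_norm0_eq0 Cx) x0; apply: functional_extensionality_dep => i.
by apply/normr0_eq0; exact: (congr1 (fun f => f i) x0).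
Qed.

Definition absolute_sum_space : normed_subspace P :=
  NormedSubspace C0 C_linear ND NZ N0.

Definition absolute_sum : Type := ns_type absolute_sum_space.

HB.instance Definition _ := NormedModule.on absolute_sum.

Lemma absolute_sum_normE (x : absolute_sum) :
  `|x| = ns_norm (as_space E) (fun i => `|ns_val x i|).
Proof. by []. Qed.

Let val (x : absolute_sum) : P := ns_val x.

Let dist (y x : absolute_sum) : E :=
  ns_mk (ns_valS (x - y : absolute_sum) :
    ns_carrier (as_space E) (norm_family (val (x - y)))).

Let norm_dist y x : `|dist y x| = `|x - y|.
Proof. by []. Qed.

Let dist_lip y x x' : `|dist y x - dist y x'| <= `|x - x'|.
Proof.
have h : forall i, `|ns_val (dist y x - dist y x') i|
    <= `|ns_val (dist x' x) i|.
  move=> i; rewrite [leRHS](normr_id (val x i - val x' i)).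
  rewrite [leLHS]/(`| `|val x i - val y i| - `|val x' i - val y i| |).
  apply: (le_trans (ler_dist_dist _ _)).
  by rewrite opprB addrA subrK.
by have [_] := as_mono (ns_valS (dist x' x)) h.
Qed.

Let coord_le x i : `|val x i| <= `|x|.
Proof.
by rewrite -[leLHS]normr_id; exact: (as_coord_le i (ns_valS (x : ns_type _))).
Qed.

Let cauchy_map (V : normedModType R) (f : absolute_sum -> V)
    (F : set_system absolute_sum) (FF : ProperFilter F) :
  (forall x y, `|f x - f y| <= `|x - y|) -> cauchy F -> cauchy (f @ F).
Proof.
move=> fl /(cauchyP F) Fc; apply/cauchy_exP => e e0.
have [x Fx] := Fc e e0; exists (f x).
rewrite -!ball_normE/= in Fx *.
by apply: (@filterS _ F _ _ _ _ Fx) => y; apply: le_lt_trans; exact: fl.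
Qed.

Let complete (F : set_system absolute_sum) :
  ProperFilter F -> cauchy F -> cvg F.
Proof.
move=> FF Fc.
have cx i : cvg (val z i @[z --> F]).
  by apply: cauchy_cvg; apply: cauchy_map => // z z'; exact: (coord_le (z - z')).
pose x : P := fun i => lim (val z i @[z --> F]).
have cd y : cvg (dist y z @[z --> F]).
  by apply: cauchy_cvg; apply: cauchy_map => // z z'; exact: dist_lip.
have wE y (w : E) i : dist y z @[z --> F] --> w -> ns_val w i = `|x i - val y i|.
  move=> yw.
  have FG : Filter (dist y z @[z --> F]) by exact: fmap_filter.
  have c1 : (fun z => `|val z i - val y i|) @ F --> (ns_val w i : R).
    exact: (@as_cvg_coord _ _ E (dist y z @[z --> F]) FG w i yw).
  have c2 : (fun z => `|val z i - val y i|) @ F --> `|x i - val y i|.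
    apply: cvg_norm; apply: cvgB; last exact: cvg_cst.
    exact: cx.
  by rewrite -(cvg_lim (@norm_hausdorff _ _) c1) (cvg_lim (@norm_hausdorff _ _) c2).
have Cx : ns_carrier (as_space E) (norm_family x).
  have /cvg_ex[/= w w0] := cd 0.
  have <- : ns_val w = norm_family x.
    by apply/funext => i; rewrite (wE 0 w i w0)/= subr0.
  exact: ns_valS.
pose xs : absolute_sum := @ns_mk _ _ absolute_sum_space x Cx.
apply/cvg_ex; exists xs; apply/cvgrPdist_lt => e e0.
have e20 : 0 < e / 2 by rewrite divr_gt0.
have /(cauchyP F) /(_ _ e20)[y Fy] := Fc.
have /cvg_ex[/= w yw] := cd y.
have nw : `|w| <= e / 2.
  apply/ler_addgt0Pr => d d0.
  near F => z.
  rewrite -(subrK (dist y z) w) addrC (le_trans (ler_normD _ _))// lerD//.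
    rewrite norm_dist distrC ltW//.
    by near: z; apply: filterS Fy => z; rewrite -ball_normE.
  by rewrite ltW//; near: z; move/cvgrPdist_lt : yw; apply.
have xy : `|xs - y| <= e / 2.
  rewrite -[`|xs - y|]/(`|dist y xs|) (_ : dist y xs = w)//.
  by apply/val_inj/funext => i; exact: esym (wE y w i yw).
apply: filterS Fy => z; rewrite -ball_normE/= => yz.
rewrite -(subrK y xs) -addrA (le_lt_trans (ler_normD _ _))//.
by rewrite [ltRHS]splitr ler_ltD.
Unshelve. all: by end_near. Qed.

HB.instance Definition _ := Uniform_isComplete.Build absolute_sum complete.

End absolute_sum.

Section ell1.
Context (R : realType).
Local Notation P := (nat -> R^o).

Let C : set P := [set a : P | cvgn (series (fun n => `|a n| : R))].
Let N (a : P) : R := limn (series (fun n => `|a n| : R)).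

Let C0 : C 0.
Proof.
rewrite /C/= (_ : series _ = cst 0); first exact: is_cvg_cst.
by apply/funext => n; rewrite /series/= big1// => k _; exact: normr0.
Qed.

Let normZE (c : R) (x : P) :
  (fun n => `|(c *: x) n|) = `|c| *: (fun n => `|x n| : R^o).
Proof. by apply/funext => n; exact: normrM. Qed.

Let CZ (c : R) x : C x -> C (c *: x).
Proof. by move=> Cx; rewrite /C/= normZE; exact: is_cvg_seriesZ. Qed.

Let sumC x y : C x -> C y ->
  cvgn (series ((fun n => `|x n| : R^o) + (fun n => `|y n| : R^o))).
Proof. exact: is_cvg_seriesD. Qed.

Let CD x y : C x -> C y -> C (x + y).
Proof.
move=> Cx Cy; apply: series_le_cvg (sumC Cx Cy) => n //.
- exact: addr_ge0.
- exact: ler_normD.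
Qed.

Let C_linear (c : R) x y : C x -> C y -> C (c *: x + y).
Proof. by move=> Cx Cy; apply: CD => //; exact: CZ. Qed.

Let ND x y : C x -> C y -> N (x + y) <= N x + N y.
Proof.
move=> Cx Cy; rewrite /N -lim_seriesD//.
apply: lim_series_le; [exact: CD|exact: sumC|] => n; exact: ler_normD.
Qed.

Let NZ (c : R) x : C x -> N (c *: x) = `|c| * N x.
Proof. by move=> Cx; rewrite /N normZE lim_seriesZ. Qed.

Let N0 x : C x -> N x = 0 -> x = 0.
Proof.
move=> Cx x0; apply/funext => n; apply/normr0_eq0/le_anti.
rewrite normr_ge0 andbT -[X in _ <= X]x0.
have nd : nondecreasing_seq (series (fun n => `|x n|)).
  exact: nondecreasing_series.
apply: le_trans (nondecreasing_cvgn_le nd Cx n.+1).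
by rewrite /series/= big_nat_recr//= lerDr sumr_ge0.
Qed.

Definition ell1 : normed_subspace P := NormedSubspace C0 C_linear ND NZ N0.

End ell1.

Section banach_notions.
Context (R : realType).

Definition lin_span (V : lmodType R) (A : set V) : set V :=
  [set v | exists (n : nat) (c : 'I_n -> R) (u : 'I_n -> V),
     (forall k, A (u k)) /\ v = \sum_(k < n) c k *: u k].

Definition dual_norm (X : normedModType R) (f : X -> R^o) : R :=
  sup [set `|f x| | x in [set x : X | `|x| <= 1]].

Definition dual_sphere (X : normedModType R) : set {linear X -> R^o} :=
  [set f | continuous f /\ dual_norm f = 1].

Definition unit_sphere (X : normedModType R) : set X := [set x | `|x| = 1].

Definition wuacs (X : completeNormedModType R) : Prop :=
  forall (x y : nat -> X) (f : {linear X -> R^o}),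
    (forall n, unit_sphere (x n)) -> (forall n, unit_sphere (y n)) ->
    dual_sphere f ->
    `|x n + y n| @[n --> \oo] --> (2 : R) ->
    f (x n) @[n --> \oo] --> (1 : R) ->
    f (y n) @[n --> \oo] --> (1 : R).

Definition luacs_plus (X : completeNormedModType R) : Prop :=
  forall (x : X) (xn : nat -> X) (f : {linear X -> R^o}),
    unit_sphere x -> (forall n, unit_sphere (xn n)) ->
    `|xn n + x| @[n --> \oo] --> (2 : R) ->
    dual_sphere f ->
    (f (xn n) @[n --> \oo] --> (1 : R) <-> f x = 1).

(* X contains an isomorphic copy of Y *)
Definition contains_copy (X Y : normedModType R) : Prop :=
  exists (T : {linear Y -> X}) (c C : R), 0 < c /\
    forall y : Y, c * `|y| <= `|T y| <= C * `|y|.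

End banach_notions.

(* Main.v *)
From HB Require Import structures.
Require Import Defs.
From mathcomp Require Import all_boot all_order all_algebra.
From mathcomp Require Import all_classical all_reals all_analysis.
From mathcomp Require Import lra ring.

(** Let [f] be a norm-one functional on the sum, and let [x_n], [y_n] be unit
vectors with [|x_n + y_n| -> 2] and [f x_n -> 1]; the point is to show
[f y_n -> 1].  Both properties say this, for different classes of pairs of
sequences: all pairs for wuacs, the pairs in which one of the two sequences is
constant for luacs+.  The argument only ever passes from a pair of sequences to
its moduli [(|x_(n,i)|)_i], to its normalised i-th components, or to a pair that
keeps one of the two moduli.  So it treats both classes at once, through the
predicate [uacs_on A B f], in which the first vector ranges over [A] and the
second over [B].

The functional [f] has a modulus [g] on E, the least positive functional with
[f x <= g |x|] ([modulus_functional]); formally [g a = sum_i |f_i| a_i], where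
[f_i] is the restriction of [f] to the i-th component, but defining it by a
supremum and the Riesz decomposition avoids infinite sums.  It has norm one and
[g |x_n| -> 1], so the hypothesis on E gives [g |y_n| -> 1].  It remains to see
that the gap [g |y_n| - f y_n >= 0] tends to zero.

The gap is additive over complementary sets of indices.  Since E contains no
copy of ell1 and the unit vectors span a dense subspace, the part of the gap
outside a suitable finite set is uniformly small ([shrinking_functional]):
otherwise there would be disjoint positive blocks on which [g] stays away from
zero, and these span a copy of ell1.  Hence it suffices to treat one index [i],
with [g e_i > 0].

For the i-th components, three facts are needed.  First, the gap of [x_n] tends
to zero, hence so does its part at [i].  Second, the triangle inequality is
asymptotically sharp at [i], that is, [|x_(n,i)| + |y_(n,i)| - |x_(n,i) +
y_(n,i)| -> 0]: the vectors [w_n], half the moduli of [x_n + y_n], satisfy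
[|(|x_n|) + w_n| -> 2], so the hypothesis on E yields [g w_n -> 1].  Third,
[y_(n,i)] is small when [x_(n,i)] is: changing the sign of [g] at [i] gives
another norm-one functional, which is still almost one at [|x_n|] when
[x_(n,i)] is small, hence also at [|y_n|].  When neither component is small,
both can be normalised, and the hypothesis on the i-th space applies
([uacs_on_rescaled]). *)

Set Implicit Arguments.
Unset Strict Implicit.
Unset Printing Implicit Defensive.

Import Order.TTheory GRing.Theory Num.Theory.
Import numFieldNormedType.Exports.
Local Open Scope classical_set_scope.
Local Open Scope ring_scope.

(** * Unit functionals and a quantitative form of the two properties *)

Section functionals.
Context {R : realType}.

(** The supremum that defines [dual_norm] takes the value 0 on unbounded sets, so
norm one already contains the boundedness of [f]. *)
Lemma dual_sphereP (X : normedModType R) (f : {linear X -> R^o}) :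
  dual_sphere f <-> (forall x, `|f x| <= `|x|) /\
    (forall e, 0 < e -> exists x, `|x| <= 1 /\ 1 - e < f x).
Proof.
rewrite /dual_sphere /dual_norm /=; set S := [set _ | _ in _].
split=> [[_ S1]|[fle fex]].
  have hS : has_sup S.
    by apply: contrapT => /sup_out; rewrite S1 => /eqP; rewrite oner_eq0.
  split=> [x|e e0].
    have [->|x0] := eqVneq x 0; first by rewrite linear0 !normr0.
    have nx : 0 < `|x| by rewrite normr_gt0.
    have : `|f (`|x|^-1 *: x)| <= 1.
      rewrite -S1; apply: ub_le_sup; first by case: hS.
      exists (`|x|^-1 *: x) => //=.
      by rewrite normrZ ger0_norm ?invr_ge0// mulVf// gt_eqF.
    by rewrite linearZ/= normrZ ger0_norm ?invr_ge0// ler_pdivrMl// mulr1.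
  have [_ [x /= x1 <-]] := sup_adherent e0 hS; rewrite S1 => h.
  have [fx|fx] := leP 0 (f x).
    by exists x; split=> //; rewrite ger0_norm// in h.
  exists (- x); rewrite normrN linearN; split=> //.
  by rewrite ltr0_norm// in h.
have ubS : ubound S 1 by move=> _ [x /= x1 <-]; exact: le_trans (fle x) x1.
split.
  apply/bounded_linear_continuous/bounded_funP => r; exists r => x.
  exact: le_trans (fle x).
apply/le_anti/andP; split.
  by apply: ge_sup => //; exists `|f 0|; exists 0 => //=; rewrite normr0.
apply/ler_addgt0Pr => e e0; have [x [x1 fx]] := fex e e0.
rewrite -lerBlDr (le_trans (ltW fx))// (le_trans (ler_norm _))//.
by apply: ub_le_sup; [exists 1|exists x].
Qed.

Lemma dual_sphere_le {X : normedModType R} {f : {linear X -> R^o}} x :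
  dual_sphere f -> `|f x| <= `|x|.
Proof. by case/dual_sphereP. Qed.

Lemma pack_linear (U V : lmodType R) (h : U -> V) :
  linear h -> exists g : {linear U -> V}, forall u, g u = h u.
Proof.
move=> hl; pose m := GRing.isLinear.Build R U V *:%R h hl.
pose g : {linear U -> V} := HB.pack h m.
by exists g.
Qed.

(** The sets [A] and [B] select the class of pairs: with both equal to [setT] this
is the condition of wuacs for [f], with one of them a singleton it is one of the
two implications of luacs+. *)
Definition uacs_on (X : normedModType R) (A B : set X) (f : X -> R) :=
  forall e : R, 0 < e -> exists2 d : R, 0 < d & forall x y : X,
    A x -> B y -> `|x| = 1 -> `|y| = 1 ->
    2 - d < `|x + y| -> 1 - d < f x -> 1 - e < f y.

Lemma uacs_on_sub {X : normedModType R} {A B A' B' : set X} {f : X -> R} :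
  uacs_on A B f -> A' `<=` A -> B' `<=` B -> uacs_on A' B' f.
Proof.
move=> H AA BB e e0; have [d d0 Hd] := H e e0.
by exists d => // x y /AA Ax /BB By; exact: Hd.
Qed.

(** If no [d] works for some [e], then the choices [d = 1 / (n + 1)] yield a pair
of sequences that contradicts the sequential condition. *)
Lemma uacs_on_seq (X : normedModType R) (A B : set X) (f : X -> R) :
  (forall x y : nat -> X, (forall n, A (x n)) -> (forall n, B (y n)) ->
    (forall n, `|x n| = 1) -> (forall n, `|y n| = 1) ->
    `|x n + y n| @[n --> \oo] --> (2 : R) ->
    f (x n) @[n --> \oo] --> (1 : R) -> f (y n) @[n --> \oo] --> (1 : R)) ->
  (forall x, f x <= `|x|) -> uacs_on A B f.
Proof.
move=> H fle e e0; apply: contrapT => nH.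
have {}nH (n : nat) : exists xy : X * X, [/\ A xy.1, B xy.2, `|xy.1| = 1,
    `|xy.2| = 1 & [/\ 2 - n.+1%:R^-1 < `|xy.1 + xy.2|,
      1 - n.+1%:R^-1 < f xy.1 & f xy.2 <= 1 - e]].
  apply: contrapT => nxy; apply: nH; exists n.+1%:R^-1 => // x y Ax By x1 y1 xy fx.
  by rewrite ltNge; apply/negP => fy; apply: nxy; exists (x, y).
have [xy xyP] := choice nH.
have sq (a : R) (u : nat -> R) : (forall n, a - n.+1%:R^-1 < u n) ->
    (forall n, u n <= a) -> u n @[n --> \oo] --> a.
  move=> lo hi; apply: (@squeeze_cvgr _ _ _ _ (fun n => a - n.+1%:R^-1) (cst a)).
  - by apply: nearW => n; rewrite (ltW (lo n)) hi.
  - rewrite -[X in _ --> X]subr0; apply: cvgB; first exact: cvg_cst.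
    exact: cvg_harmonic.
  - exact: cvg_cst.
have cn : `|(xy n).1 + (xy n).2| @[n --> \oo] --> (2 : R).
  apply: sq => n; first by case: (xyP n) => _ _ _ _ [].
  by case: (xyP n) => _ _ x1 y1 _; rewrite (le_trans (ler_normD _ _))// x1 y1.
have cf : f (xy n).1 @[n --> \oo] --> (1 : R).
  apply: sq => n; first by case: (xyP n) => _ _ _ _ [].
  by case: (xyP n) => _ _ x1 y1 _; rewrite (le_trans (fle _))// x1.
have [] // := H (fun n => (xy n).1) (fun n => (xy n).2) _ _ _ _ cn cf
  (ball (1 : R) e) (nbhsx_ballx _ _ e0); [by move=> n; case: (xyP n)..|].
move=> N _ /(_ N (leqnn N)); rewrite -ball_normE/=.
case: (xyP N) => _ _ _ _ [_ _ fy].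
by apply/negP; rewrite -leNgt (le_trans _ (ler_norm _))//; lra.
Qed.

Lemma wuacs_uacs_on (X : completeNormedModType R) (f : {linear X -> R^o}) :
  wuacs X -> dual_sphere f -> uacs_on setT setT f.
Proof.
move=> wX df; apply: uacs_on_seq => [x y _ _ x1 y1|x].
  exact: wX.
exact: le_trans (ler_norm _) (dual_sphere_le x df).
Qed.

(** The hypothesis [f x_n -> 1] on a constant sequence forces [f x0 = 1], so this
is the implication from right to left in luacs+; the next lemma is the other
one. *)
Lemma luacs_uacs_onl (X : completeNormedModType R) (f : {linear X -> R^o}) x0 :
  luacs_plus X -> dual_sphere f -> uacs_on [set x0] setT f.
Proof.
move=> lX df; apply: uacs_on_seq => [x y xx0 _ x1 y1|x]; last first.
  exact: le_trans (ler_norm _) (dual_sphere_le x df).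
have -> : x = cst x0 by apply/funext.
move=> xy fx; have fx0 : f x0 = 1.
  exact: (cvg_unique (@norm_hausdorff _ R^o) (@cvg_cst _ (f x0) _ \oo _) fx).
apply/(lX x0 y f _ _ _ df) => //; first by rewrite /unit_sphere/= -(xx0 0%N).
by under eq_cvg do rewrite addrC.
Qed.

Lemma luacs_uacs_onr (X : completeNormedModType R) (f : {linear X -> R^o}) y0 :
  luacs_plus X -> dual_sphere f -> uacs_on setT [set y0] f.
Proof.
move=> lX df; apply: uacs_on_seq => [x y _ yy0 x1 y1|x]; last first.
  exact: le_trans (ler_norm _) (dual_sphere_le x df).
have -> : y = cst y0 by apply/funext.
move=> xy fx; rewrite (_ : (fun=> _) = cst 1); first exact: cvg_cst.
apply/funext => _ /=; apply/(lX y0 x f _ _ _ df) => //.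
by rewrite /unit_sphere/= -(yy0 0%N).
Qed.

(** The vectors [y n] are only asymptotically of norm one, as is the case for the
halved moduli of [x_n + y_n]; normalising them changes neither limit. *)
Lemma uacs_on_cvg {X : normedModType R} {A : set X} {f : {linear X -> R^o}}
    {B : set X} {x y : nat -> X} :
  uacs_on A B f -> (forall x, `|f x| <= `|x|) ->
  (forall n, A (x n)) -> (forall n, B (`|y n|^-1 *: y n)) ->
  (forall n, `|x n| = 1) ->
  `|y n| @[n --> \oo] --> (1 : R) ->
  `|x n + y n| @[n --> \oo] --> (2 : R) ->
  f (x n) @[n --> \oo] --> (1 : R) -> f (y n) @[n --> \oo] --> (1 : R).
Proof.
move=> H fle Ax By x1 y1 xy fx; apply/cvgrPdist_lt => e e0.
have e3 : 0 < e / 2 by rewrite divr_gt0.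
have [d d0 Hd] := H _ e3.
have d2 : 0 < d / 2 by rewrite divr_gt0.
have h2 : (0 : R) < 1 / 2 by rewrite divr_gt0.
near=> n.
have n1 : `|1 - `|y n| | < 1 / 2 by near: n; move/cvgrPdist_lt : y1; apply.
have n2 : `|1 - `|y n| | < e / 2 by near: n; move/cvgrPdist_lt : y1; apply.
have n3 : `|1 - `|y n| | < d / 2 by near: n; move/cvgrPdist_lt : y1; apply.
have n4 : `|2 - `|x n + y n| | < d / 2 by near: n; move/cvgrPdist_lt : xy; apply.
have n5 : `|1 - f (x n)| < d by near: n; move/cvgrPdist_lt : fx; apply.
have y0 : 0 < `|y n| by move: n1; rewrite ltr_norml => /andP[_ ?] *; lra.
set z := `|y n|^-1 *: y n.
have nz : `|z| = 1 by rewrite normrZ ger0_norm ?invr_ge0// mulVf// gt_eqF.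
have zy : `|z - y n| = `|1 - `|y n| |.
  rewrite /z -[X in _ - X]scale1r -scalerBl normrZ.
  rewrite -[X in _ * X](ger0_norm (normr_ge0 _)).
  by rewrite -normrM mulrBl mulVf ?mul1r// gt_eqF.
have fz : 1 - e / 2 < f z.
  apply: (Hd (x n) z) => //; first exact: (By n).
    have : `|x n + y n| <= `|x n + z| + `|z - y n|.
      by rewrite -(distrC (y n)) (le_trans _ (ler_normD _ _))// addrACA subrr addr0.
    have zyd : `|z - y n| < d / 2 by rewrite zy.
    by move: n4; rewrite ltr_norml => /andP[_ ?] *; lra.
  move: n5; rewrite ltr_norml => /andP[_ ?] *; lra.
have fzy : `|f z - f (y n)| < e / 2.
  by rewrite -linearB (le_lt_trans (fle _))// zy.
have fz1 : f z <= 1 by rewrite -nz (le_trans (ler_norm _)).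
move: fzy; rewrite !ltr_norml => /andP[? ?]; apply/andP; split; lra.
Unshelve. all: by end_near. Qed.

End functionals.

(** * Comparing vectors of different lengths *)

Section rescaling.
Context {R : realType} {X : normedModType R}.

Lemma norm_normalized (u : X) : u != 0 -> `| `|u|^-1 *: u| = 1.
Proof.
by move=> u0; rewrite normrZ ger0_norm ?invr_ge0// mulVf ?normr_eq0.
Qed.

(** If [|u| <= |v|], then [u + v] is [|u|] times the sum of the two unit vectors
plus a multiple of norm [|v| - |u|] of the second one.  So a loss in the sum of
the unit vectors is felt, scaled by [|u| >= m], in the sum of [u] and [v]. *)
Lemma normalized_add_ge (u v : X) (m : R) :
  0 < m -> m <= `|u| -> m <= `|v| ->
  m * (2 - `| `|u|^-1 *: u + `|v|^-1 *: v|) <= `|u| + `|v| - `|u + v|.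
Proof.
wlog uv : u v / `|u| <= `|v| => [H m0 mu mv|m0 mu _].
  have [uv|/ltW vu] := leP `|u| `|v|; first exact: H.
  by have := H v u vu m0 mv mu; rewrite (addrC `|v|) (addrC (_ *: v)) (addrC v).
have a0 : 0 < `|u| by exact: lt_le_trans mu.
have b0 : 0 < `|v| by exact: lt_le_trans uv.
set p := _ *: u; set q := _ *: v.
have np : `|p| = 1 by apply: norm_normalized; rewrite -normr_gt0.
have nq : `|q| = 1 by apply: norm_normalized; rewrite -normr_gt0.
have uE : u + v = `|u| *: (p + q) + (`|v| - `|u|) *: q.
  rewrite scalerDr -addrA -scalerDl (addrC `|u|) subrK /p /q !scalerA.
  by rewrite !mulfV ?scale1r// gt_eqF.
have h : `|u + v| <= `|u| * `|p + q| + (`|v| - `|u|).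
  rewrite {1}uE (le_trans (ler_normD _ _))// (normrZ _ (p + q)) (normrZ _ q).
  rewrite nq mulr1 normr_id.
  by rewrite ger0_norm// subr_ge0.
have s2 : 0 <= 2 - `|p + q|.
  by rewrite subr_ge0 (le_trans (ler_normD _ _))// np nq.
have := ler_wpM2r s2 mu; rewrite mulrBr.
lra.
Qed.

(** Where [v n] is small, [|v n| - h (v n)] is small as well; elsewhere [u n] and
[v n] are both bounded away from zero, and the property applies to their
normalisations. *)
Lemma uacs_on_rescaled {A B : set X} {h : {linear X -> R^o}} {u v : nat -> X} :
  uacs_on A B h -> (forall x, `|h x| <= `|x|) ->
  (forall n, A (`|u n|^-1 *: u n)) -> (forall n, B (`|v n|^-1 *: v n)) ->
  (forall n, `|v n| <= 1) ->
  (forall e : R, 0 < e -> exists2 r : R, 0 < r &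
    \forall n \near \oo, `|u n| < r -> `|v n| < e) ->
  `|u n| + `|v n| - `|u n + v n| @[n --> \oo] --> (0 : R) ->
  `|u n| - h (u n) @[n --> \oo] --> (0 : R) ->
  `|v n| - h (v n) @[n --> \oo] --> (0 : R).
Proof.
move=> H hle Au Bv v1 uv0 cuv cu; apply/cvgr0Pnorm_lt => e e0.
have e2 : 0 < e / 2 by rewrite divr_gt0.
have [r r0 Hr] := uv0 _ e2.
have [d d0 Hd] := H _ e2.
have m0 : 0 < Num.min r (e / 2) by rewrite lt_min r0.
set m := Num.min _ _ in m0.
have dm : 0 < m * d by rewrite mulr_gt0.
near=> n.
have nr : `|u n| < r -> `|v n| < e / 2 by near: n.
have n1 : `| `|u n| + `|v n| - `|u n + v n| | < m * d.
  by near: n; move/cvgr0Pnorm_lt : cuv; apply.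
have n2 : `| `|u n| - h (u n)| < m * d.
  by near: n; move/cvgr0Pnorm_lt : cu; apply.
have hv := hle (v n); rewrite ler_norml in hv; case/andP : hv => hv1 hv2.
rewrite ger0_norm ?subr_ge0//.
have [ve|ev] := ltP `|v n| (e / 2); first lra.
have ru : r <= `|u n|.
  by rewrite leNgt; apply/negP => /nr; apply/negP; rewrite -leNgt.
have mu : m <= `|u n| by rewrite ge_min ru.
have mv : m <= `|v n| by rewrite ge_min ev orbT.
have u0 : 0 < `|u n| by exact: lt_le_trans ru.
have v0 : 0 < `|v n| by exact: lt_le_trans ev.
set p := `|u n|^-1 *: u n; set q := `|v n|^-1 *: v n.
have hp : `|u n| * h p = h (u n) by rewrite /p linearZ/= mulrA mulfV ?mul1r ?gt_eqF.
have hq : `|v n| * h q = h (v n) by rewrite /q linearZ/= mulrA mulfV ?mul1r ?gt_eqF.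
have np : `|p| = 1 by apply: norm_normalized; rewrite -normr_gt0.
have nq : `|q| = 1 by apply: norm_normalized; rewrite -normr_gt0.
have : 1 - e / 2 < h q.
  apply: (Hd p q (Au n) (Bv n) np nq).
    have := normalized_add_ge m0 mu mv; rewrite -/p -/q => le1.
    have := le_lt_trans le1 (le_lt_trans (ler_norm _) n1).
    by rewrite ltr_pM2l//; lra.
  have hp1 : 0 <= 1 - h p by rewrite subr_ge0 (le_trans (ler_norm _))// -np.
  have le1 : m * (1 - h p) <= `|u n| - h (u n).
    by rewrite -hp -[leRHS](_ : `|u n| * (1 - h p) = _) ?ler_wpM2r// mulrBr mulr1.
  have := le_lt_trans le1 (le_lt_trans (ler_norm _) n2).
  by rewrite ltr_pM2l//; lra.
move=> hq1.
have -> : `|v n| - h (v n) = `|v n| * (1 - h q) by rewrite mulrBr mulr1 hq.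
have hq2 : 0 <= 1 - h q by rewrite subr_ge0 (le_trans (ler_norm _))// -nq.
apply: (@le_lt_trans _ _ (1 - h q)); first by rewrite ler_piMl.
lra.
Unshelve. all: by end_near. Qed.

End rescaling.

(** * Lattice structure of E and the modulus of a functional on the sum *)

Section lattice.
Context {R : realType} {I : Type} {E : absolute_space R I}.
Implicit Types (a b : E) (A : set I).

Definition entry a (i : I) : R := ns_val a i.

Lemma entryD a b i : entry (a + b) i = entry a i + entry b i.
Proof. by []. Qed.

Lemma entryN a i : entry (- a) i = - entry a i.
Proof. by []. Qed.

Lemma entryZ (c : R) a i : entry (c *: a) i = c * entry a i.
Proof. by []. Qed.

Lemma entry_e i : entry (as_e E i) i = 1.
Proof. by rewrite /entry/= indicE mem_set. Qed.

Lemma entry_e_neq i j : j <> i -> entry (as_e E i) j = 0.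
Proof. by move=> ji; rewrite /entry/= indicE memNset. Qed.

Lemma entry_inj a b : (forall i, entry a i = entry b i) -> a = b.
Proof. by move=> ab; apply/val_inj/funext. Qed.

Lemma norm_le_entry a b : (forall i, `|entry a i| <= `|entry b i|) ->
  `|a| <= `|b|.
Proof. by move=> ab; have [] := as_mono (ns_valS b) ab. Qed.

Lemma entry_le_norm a i : `|entry a i| <= `|a|.
Proof. exact: as_coord_le (ns_valS a). Qed.

(** An absolute norm is solid: a family that is bounded coordinatewise by an
element of E belongs to E. *)
Definition solid (v : I -> R) b (vb : forall i, `|v i| <= `|entry b i|) : E :=
  ns_mk (proj1 (as_mono (ns_valS b) vb)).

Fact abs_subproof a i : `| `|entry a i| | <= `|entry a i|.
Proof. by rewrite normr_id. Qed.
Definition abs a : E := solid (abs_subproof a).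

Lemma entry_abs a i : entry (abs a) i = `|entry a i|.
Proof. by []. Qed.

Lemma norm_abs a : `|abs a| = `|a|.
Proof.
apply/le_anti/andP.
by split; apply: norm_le_entry => i; rewrite entry_abs normr_id.
Qed.

Fact restr_subproof A a i :
  `|if `[< A i >] then entry a i else 0| <= `|entry a i|.
Proof. by case: asboolP => // _; rewrite normr0. Qed.
Definition restr A a : E := solid (restr_subproof A a).

Lemma entry_restr A a i :
  entry (restr A a) i = if `[< A i >] then entry a i else 0.
Proof. by []. Qed.

Lemma norm_restr A a : `|restr A a| <= `|a|.
Proof. by apply: norm_le_entry => i; exact: restr_subproof. Qed.

Lemma restrC A a : a = restr A a + restr (~` A) a.
Proof.
apply: entry_inj => i; rewrite entryD !entry_restr.
have [Ai|Ai] := asboolP (A i).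
  by rewrite asboolF ?addr0// => /(_ Ai).
by rewrite asboolT ?add0r.
Qed.

Lemma restr1 i a : restr [set i] a = entry a i *: as_e E i.
Proof.
apply: entry_inj => j; rewrite entryZ entry_restr.
have [->|ji] := asboolP ([set i] j); first by rewrite entry_e mulr1.
by rewrite entry_e_neq// mulr0.
Qed.

Definition flip i a : E := a - 2 *: restr [set i] a.

Lemma norm_flip i a : `|flip i a| = `|a|.
Proof.
have h j : `|entry (flip i a) j| = `|entry a j|.
  rewrite /flip entryD entryN entryZ entry_restr.
  case: asboolP => _; last by rewrite mulr0 subr0.
  by rewrite -[in RHS]normrN; congr (`|_|); ring.
by apply/le_anti/andP; split; apply: norm_le_entry => j; rewrite h.
Qed.

Definition nonneg a := forall i, 0 <= entry a i.

Lemma nonneg_abs a : nonneg (abs a).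
Proof. by move=> i; rewrite entry_abs. Qed.

Lemma nonneg_restr A a : nonneg a -> nonneg (restr A a).
Proof. by move=> a0 i; rewrite entry_restr; case: ifP. Qed.

Lemma nonneg_e i : nonneg (as_e E i).
Proof.
move=> j; have [->|ji] := pselect (j = i); first by rewrite entry_e.
by rewrite entry_e_neq.
Qed.

Lemma nonnegD a b : nonneg a -> nonneg b -> nonneg (a + b).
Proof. by move=> a0 b0 i; rewrite entryD addr_ge0. Qed.

Lemma nonnegZ (c : R) a : 0 <= c -> nonneg a -> nonneg (c *: a).
Proof. by move=> c0 a0 i; rewrite entryZ mulr_ge0. Qed.

Definition pos a : E := 2^-1 *: (abs a + a).

Lemma nonneg_pos a : nonneg (pos a).
Proof.
move=> i; rewrite entryZ entryD entry_abs mulr_ge0//.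
by have := ler_norm (- entry a i); rewrite normrN; lra.
Qed.

Lemma pos_sub a : a = pos a - pos (- a).
Proof.
have -> : pos (- a) = 2^-1 *: (abs a - a).
  by apply: entry_inj => i; rewrite !entryZ !entryD !entry_abs entryN normrN.
by apply: entry_inj => i; rewrite entryD entryN !entryZ !entryD entryN; field.
Qed.

Lemma pos_add a : pos a + pos (- a) = abs a.
Proof.
have -> : pos (- a) = 2^-1 *: (abs a - a).
  by apply: entry_inj => i; rewrite !entryZ !entryD !entry_abs entryN normrN.
by apply: entry_inj => i; rewrite entryD !entryZ !entryD entryN; field.
Qed.

End lattice.

Section sum.
Context {R : realType} {I : Type} {E : absolute_space R I}.
Context {X : I -> completeNormedModType R}.
Local Notation S := (absolute_sum E X).
Implicit Types (x y : S) (a b : E) (A : set I).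

Definition cmpt x (i : I) : X i := ns_val x i.

Lemma cmptD x y i : cmpt (x + y) i = cmpt x i + cmpt y i.
Proof. by []. Qed.

Lemma cmptZ (c : R) x i : cmpt (c *: x) i = c *: cmpt x i.
Proof. by []. Qed.

Lemma cmpt_inj x y : (forall i, cmpt x i = cmpt y i) -> x = y.
Proof.
by move=> xy; apply/val_inj; apply: functional_extensionality_dep.
Qed.

Definition modulus x : E := ns_mk (ns_valS x : ns_carrier (as_space E) _).

Lemma entry_modulus x i : entry (modulus x) i = `|cmpt x i|.
Proof. by []. Qed.

Lemma modulus0 : modulus 0 = 0.
Proof. by apply: entry_inj => i; rewrite entry_modulus normr0. Qed.

Lemma norm_modulus x : `|modulus x| = `|x|.
Proof. by []. Qed.

Lemma nonneg_modulus x : nonneg (modulus x).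
Proof. by move=> i; rewrite entry_modulus. Qed.

Definition dominated x a := forall i, `|cmpt x i| <= entry a i.

Lemma dominated_modulus x : dominated x (modulus x).
Proof. by []. Qed.

Lemma dominated_norm x a : dominated x a -> `|x| <= `|a|.
Proof.
move=> xa; rewrite -norm_modulus; apply: norm_le_entry => i.
by rewrite entry_modulus normr_id (le_trans (xa i))// ler_norm.
Qed.

Fact solid_sum_subproof (v : family_prod X) a :
  (forall i, `|v i| <= entry a i) ->
  ns_carrier (absolute_sum_space E X) v.
Proof.
move=> va; have [] // := as_mono (a := norm_family v) (ns_valS a) => i.
by rewrite /norm_family normr_id (le_trans (va i))// ler_norm.
Qed.
Definition solid_sum (v : family_prod X) a (va : forall i, `|v i| <= entry a i)
  : S := ns_mk (solid_sum_subproof va).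

(** Each component of [z] is split in the ratio of [a i] to [b i]. *)
Lemma riesz_decomposition z a b : nonneg a -> nonneg b -> dominated z (a + b) ->
  exists x y, [/\ z = x + y, dominated x a & dominated y b].
Proof.
move=> a0 b0 zab; pose t i := entry a i / (entry a i + entry b i).
have t0 i : 0 <= t i by rewrite divr_ge0// addr_ge0.
have t1 i : t i <= 1.
  have ab0 : 0 <= entry a i + entry b i by rewrite addr_ge0.
  rewrite /t; have [ab|ab] := eqVneq (entry a i + entry b i) 0.
    by rewrite ab invr0 mulr0.
  by rewrite ler_pdivrMr ?mul1r ?lerDl// lt_neqAle eq_sym ab.
have tE i : t i * (entry a i + entry b i) = entry a i.
  rewrite /t; have [ab|ab] := eqVneq (entry a i + entry b i) 0.
    rewrite ab mulr0; apply/esym/eqP.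
    by move/eqP : ab; rewrite paddr_eq0// => /andP[].
  by rewrite divfK.
have xa i : `|t i *: cmpt z i| <= entry a i.
  by rewrite normrZ ger0_norm// -[leRHS]tE ler_wpM2l//; exact: zab.
have yb i : `|(1 - t i) *: cmpt z i| <= entry b i.
  have -> : entry b i = (1 - t i) * (entry a i + entry b i).
    by rewrite mulrBl tE mul1r; ring.
  have t1' : 0 <= 1 - t i by rewrite subr_ge0.
  by rewrite normrZ ger0_norm// ler_wpM2l//; exact: zab.
exists (solid_sum (v := fun i => t i *: cmpt z i) xa).
exists (solid_sum (v := fun i => (1 - t i) *: cmpt z i) yb); split=> //.
apply: cmpt_inj => i.
rewrite cmptD -[in RHS]/(t i *: cmpt z i + (1 - t i) *: cmpt z i).
by rewrite -scalerDl addrC subrK scale1r.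
Qed.

Lemma dominatedD x y a b : dominated x a -> dominated y b ->
  dominated (x + y) (a + b).
Proof.
move=> xa yb i; rewrite cmptD entryD (le_trans (ler_normD _ _))//.
by apply: lerD; [exact: xa|exact: yb].
Qed.

Lemma dominatedZ (c : R) x a : 0 <= c -> dominated x a ->
  dominated (c *: x) (c *: a).
Proof.
move=> c0 xa i; rewrite cmptZ entryZ normrZ ger0_norm// ler_wpM2l//.
exact: xa.
Qed.

Variable f : {linear S -> R^o}.
Hypothesis f_le : forall x, `|f x| <= `|x|.

(* [p a] is the value at [a >= 0] of the modulus of [f]; on the positive cone it
   is additive by the Riesz decomposition. *)
Let p a : R := sup [set (f x : R) | x in [set x | dominated x a]].

Let p_ge x a : dominated x a -> f x <= p a.
Proof.
move=> xa; apply: ub_le_sup; last by exists x.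
exists `|a| => _ [y /= ya <-].
by rewrite (le_trans (ler_norm _))// (le_trans (f_le _))// dominated_norm.
Qed.

Let p_le a (t : R) : nonneg a -> (forall x, dominated x a -> f x <= t) ->
  p a <= t.
Proof.
move=> a0 H; apply: ge_sup => [|_ [x /= xa <-]]; last exact: H.
by exists (f 0), 0 => //= i; rewrite normr0 a0.
Qed.

Let pD a b : nonneg a -> nonneg b -> p (a + b) = p a + p b.
Proof.
move=> a0 b0; apply/le_anti/andP; split.
  apply: p_le => [|z]; first exact: nonnegD.
  move=> /(riesz_decomposition a0 b0)[x [y [-> xa yb]]].
  by rewrite linearD lerD// p_ge.
rewrite -lerBrDr; apply: p_le => // x xa; rewrite lerBrDr addrC -lerBrDr.
apply: p_le => // y yb; rewrite lerBrDr addrC -linearD p_ge//.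
exact: dominatedD.
Qed.

Let pZ (c : R) a : 0 <= c -> nonneg a -> p (c *: a) = c * p a.
Proof.
have le (d : R) b : 0 < d -> nonneg b -> d * p b <= p (d *: b).
  move=> d0 b0; rewrite -ler_pdivlMl//; apply: p_le => // x xb.
  rewrite ler_pdivlMl// -[_ * _]/(d *: (f x : R^o)) -linearZ.
  by apply/p_ge/dominatedZ => //; exact: ltW.
rewrite le_eqVlt => /predU1P[<- a0|c0 a0].
  rewrite scale0r mul0r; have := pD a0 (_ : nonneg (0 : E)) => /(_ (fun=> lexx _)).
  by rewrite addr0 => pa; lra.
apply/le_anti/andP; split; last exact: le.
rewrite -ler_pdivrMl// -{2}[a]scale1r -(mulVf (lt0r_neq0 c0)) -scalerA.
apply: le; first by rewrite invr_gt0.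
by apply: nonnegZ => //; exact: ltW.
Qed.

(** The modulus of [f], that is, the least functional that dominates [f].  It
extends the additive and positively homogeneous map [p] from the positive cone
to E by [g (u - v) = p u - p v]. *)
Lemma modulus_functional : exists g : {linear E -> R^o},
  [/\ forall a, `|g a| <= `|a|,
      forall x a, dominated x a -> f x <= g a &
      forall a (t : R), nonneg a -> (forall x, dominated x a -> f x <= t) ->
        g a <= t].
Proof.
pose h a : R^o := p (pos a) - p (pos (- a)).
have hE u v : nonneg u -> nonneg v -> h (u - v) = p u - p v.
  move=> u0 v0; rewrite /h; set a := u - v.
  (* two representations of [a] as a difference of positive elements *)
  have : p (pos a + v) = p (u + pos (- a)).
    by congr p; rewrite -[X in X + v](subrK (pos (- a))) -pos_sub addrAC subrK.
  rewrite !pD//; [|exact: nonneg_pos..].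
  move=> e; apply/eqP; rewrite subr_eq addrAC eq_sym subr_eq -e; apply/eqP; ring.
have h1 a : nonneg a -> h a = p a.
  move=> a0; rewrite -{1}[a]subr0 hE//.
  by rewrite -(scale0r a) pZ// mul0r subr0.
have hZD (d : R) u v u' v' : 0 <= d ->
    nonneg u -> nonneg v -> nonneg u' -> nonneg v' ->
    h ((d *: u + v) - (d *: u' + v')) = d * (p u - p u') + (p v - p v').
  move=> d0 u0 v0 u0' v0'; have du := nonnegZ d0 u0; have du' := nonnegZ d0 u0'.
  rewrite hE; [|exact: nonnegD|exact: nonnegD].
  by rewrite pD// pD// pZ// pZ//; ring.
have hlin : linear h.
  move=> c a b; rewrite {1}(pos_sub a) {1}(pos_sub b).
  have [c0|c0] := leP 0 c.
    have -> : c *: (pos a - pos (- a)) + (pos b - pos (- b)) =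
       (c *: pos a + pos b) - (c *: pos (- a) + pos (- b)).
      by rewrite scalerBr opprD addrACA.
    by rewrite hZD//; exact: nonneg_pos.
  have nc : 0 <= - c by rewrite oppr_ge0 ltW.
  have -> : c *: (pos a - pos (- a)) + (pos b - pos (- b)) =
     ((- c) *: pos (- a) + pos b) - ((- c) *: pos a + pos (- b)).
    rewrite scalerBr !scaleNr opprD opprK [in RHS]addrACA; congr (_ + _).
    exact: addrC.
  rewrite hZD//; [|exact: nonneg_pos..].
  by rewrite /h -[_ *: _]/(c * _); ring.
have [g gE] := pack_linear hlin; exists g; split.
- move=> a; have p0 b : nonneg b -> 0 <= p b.
    by move=> b0; rewrite -(linear0 f) p_ge// => i; rewrite normr0.
  rewrite gE /h (@le_trans _ _ (p (pos a) + p (pos (- a))))//.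
    rewrite (le_trans (ler_normB _ _))// !ger0_norm//; exact/p0/nonneg_pos.
  rewrite -pD; [|exact: nonneg_pos..].
  rewrite pos_add; apply: p_le => [|x xa]; first exact: nonneg_abs.
  by rewrite (le_trans (ler_norm _))// (le_trans (f_le _))// -norm_abs dominated_norm.
- move=> x a xa; have a0 : nonneg a by move=> i; exact: le_trans (xa i).
  by rewrite gE h1// p_ge.
- by move=> a t a0 H; rewrite gE h1//; exact: p_le.
Qed.

End sum.

(** * Without copies of ell1, positive functionals have small tails *)

Section shrinking.
Context {R : realType} {I : Type} {E : absolute_space R I}.
Implicit Types (a b : E) (F : set I).

Definition supp a : set I := [set i | entry a i != 0].

Lemma supp_out a i : ~ supp a i -> entry a i = 0.
Proof. by move=> /negP/negPn/eqP. Qed.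

Lemma finite_supp_span a :
  lin_span (range (@as_e R I E)) a -> finite_set (supp a).
Proof.
move=> [n [c [u [uE ->]]]]; elim/big_ind : _ => [|v w fv fw|k _].
- rewrite (_ : supp _ = set0)//; apply/seteqP; split=> // i.
  by rewrite /supp/= eqxx.
- apply: (@sub_finite_set _ _ (supp v `|` supp w)); last by rewrite finite_setU.
  move=> i /= vwi; apply: contrapT => /not_orP[/supp_out vi /supp_out wi].
  have vw0 : entry (v + w) i = 0 by rewrite entryD vi wi addr0.
  by move/eqP : vwi; apply.
- have [i _ <-] := uE k.
  apply: (@sub_finite_set _ _ [set i]) => // j /eqP h.
  have [//|ji] := pselect (j = i).
  suff /h : entry (c k *: as_e E i) j = 0 by [].
  by rewrite entryZ entry_e_neq// mulr0.
Qed.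

(** Restricting [a] to the support of a finitely supported approximation is at
least as good an approximation. *)
Lemma finite_restr_approx a (e : R) :
  dense (lin_span (range (@as_e R I E))) -> 0 < e ->
  exists2 F, finite_set F & `|a - restr F a| < e.
Proof.
move=> dE e0; have [] := dE (ball a e).
- by exists a; exact: ballxx.
- exact: ball_open.
move=> s []; rewrite -ball_normE/= => as_e /finite_supp_span fs.
exists (supp s) => //; apply: le_lt_trans as_e.
apply: norm_le_entry => i; rewrite !entryD !entryN entry_restr.
by case: asboolP => [_|/supp_out ->]; rewrite ?subrr ?normr0.
Qed.

Variable g : {linear E -> R^o}.
Hypothesis g_le : forall a, `|g a| <= `|a|.

(* The blocks [b n] are positive and disjoint: [F n] contains the supports of the
   blocks before the n-th one, which vanishes on [F n]. *)
Section blocks.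
Variables (e : R) (b : nat -> E) (F : nat -> set I).
Hypothesis e_gt0 : 0 < e.
Hypothesis b_nonneg : forall n, nonneg (b n).
Hypothesis b_le1 : forall n, `|b n| <= 1.
Hypothesis b_ge : forall n, e <= g (b n).
Hypothesis F_b : forall m n i, (m < n)%N -> supp (b m) i -> F n i.
Hypothesis b_F : forall n i, F n i -> entry (b n) i = 0.

Let comb (t : nat -> R) n : E := \sum_(k < n) t k *: b k.

Let combS t n : comb t n.+1 = comb t n + t n *: b n.
Proof. exact: big_ord_recr. Qed.

(* By disjointness of the supports, taking absolute values of the coefficients
   takes the absolute value of the combination, and does not change its norm. *)
Let abs_comb t n i : entry (comb (fun k => `|t k|) n) i = `|entry (comb t n) i|.
Proof.
elim: n => [|n IH]; first by rewrite /comb !big_ord0 [RHS]normr0.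
rewrite !combS !entryD !entryZ IH.
have [Fi|nFi] := pselect (F n i).
  by rewrite b_F// !mulr0 !addr0.
have -> : entry (comb t n) i = 0.
  rewrite /comb; elim/big_ind : _ => // [u v ui vi|k _].
    by rewrite entryD ui vi addr0.
  rewrite entryZ supp_out ?mulr0// => bi; apply: nFi; exact: F_b bi.
by rewrite normr0 !add0r normrM (ger0_norm (b_nonneg n i)).
Qed.

Let comb_ge (t : nat -> R) n : e * (\sum_(k < n) `|t k|) <= `|comb t n|.
Proof.
apply: (@le_trans _ _ `|comb (fun k => `|t k|) n|); last first.
  by apply: norm_le_entry => i; rewrite abs_comb normr_id.
apply: le_trans (g_le _); apply: le_trans (ler_norm _).
rewrite /comb linear_sum/= mulr_sumr ler_sum// => k _.
by rewrite linearZ/= mulrC ler_wpM2l.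
Qed.

(** The copy of ell1 is the map that sends [t] to the sum of the [t_k b_k].  Its
lower bound comes from [g]: since signs of coefficients do not matter for the
norm, [|sum_k t_k b_k| >= g (sum_k |t_k| b_k) >= e * sum_k |t_k|]. *)
Lemma ell1_of_blocks : contains_copy E (ell1 R).
Proof.
pose u (t : ell1 R) k : E := (ns_val t k : R) *: b k.
have nu t k : `|u t k| <= `|ns_val t k|.
  by rewrite normrZ ler_piMr.
have cl (t : ell1 R) : cvgn (series (fun k => `|ns_val t k| : R)) := ns_valS t.
have nl (t : ell1 R) : `|t| = limn (series (fun k => `|ns_val t k| : R)) by [].
have cn t : cvgn [normed series (u t)].
  exact: series_le_cvg (nu t) (cl t).
have cu t : series (u t) @ \oo --> limn (series (u t)) by exact: normed_cvg.
pose T t : E := limn (series (u t)).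
have Tlin : linear T.
  move=> c t s; apply: (cvg_lim (@norm_hausdorff _ _)).
  have -> : series (u (c *: t + s)) =
      (fun n => c *: series (u t) n + series (u s) n).
    apply/funext => n; rewrite /series/= scaler_sumr -big_split/=.
    apply: eq_bigr => k _; rewrite /u scalerA -scalerDl; congr (_ *: _).
  by apply: cvgD; [apply: cvgZl_tmp|]; exact: cu.
have [G GE] := pack_linear Tlin.
exists G, e, 1; split=> // t; rewrite GE mul1r; apply/andP; split.
- rewrite nl.
  have c1 : e * series (fun k => `|ns_val t k| : R) n @[n --> \oo] --> e * `|t|.
    by apply: cvgMl_tmp; exact: cl.
  have c2 : `|series (u t) n| @[n --> \oo] --> `|T t| by exact: cvg_norm.
  apply: ler_cvg_to c1 c2 _; apply: nearW => n.
  rewrite /series/= !big_mkord; exact: comb_ge.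
- rewrite nl; apply: le_trans (lim_series_norm (cn t)) _.
  exact: lim_series_le (cn t) (cl t) (nu t).
Qed.

End blocks.

Hypothesis E_dense : dense (lin_span (range (@as_e R I E))).
Hypothesis E_ell1 : ~ contains_copy E (ell1 R).

(** If the tails of [g] were not small, then a vector [a] on which [g] exceeds [e]
could be found off every finite set, and by density such an [a] can be taken
finitely supported.  Adding its support to the finite set and repeating yields
the blocks of a copy of ell1. *)
Lemma shrinking_functional (e : R) : 0 < e ->
  exists2 F, finite_set F & forall a, nonneg a -> `|a| <= 1 ->
    (forall i, F i -> entry a i = 0) -> g a <= e.
Proof.
move=> e0; apply: contrapT => nF.
have blk F : exists b, finite_set F -> [/\ nonneg b, `|b| <= 1,
    forall i, F i -> entry b i = 0, e <= g b & finite_set (supp b)].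
  have [fF|nfF] := pselect (finite_set F); last by exists 0.
  have : exists a, [/\ nonneg a, `|a| <= 1, forall i, F i -> entry a i = 0 & e < g a].
    apply: contrapT => na; apply: nF; exists F => // a a0 a1 aF.
    by rewrite leNgt; apply/negP => ga; apply: na; exists a.
  move=> [a [a0 a1 aF ga]].
  have [|G fG aG] := finite_restr_approx a E_dense (_ : 0 < g a - e).
    by rewrite subr_gt0.
  exists (restr G a) => _; split.
  - exact: nonneg_restr.
  - exact: le_trans (norm_restr _ _) a1.
  - by move=> i Fi; rewrite entry_restr aF// if_same.
  - have := le_lt_trans (le_trans (ler_norm _) (g_le _)) aG.
    by rewrite linearB/=; lra.
  - apply: sub_finite_set fG => i /eqP; rewrite entry_restr.
    by case: asboolP.
have [B BP] := choice blk.
pose Fs := fix Fs n := if n is m.+1 then Fs m `|` supp (B (Fs m)) else set0.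
have fFs n : finite_set (Fs n).
  by elim: n => //= n IH; rewrite finite_setU; split=> //; case: (BP _ IH).
apply: E_ell1; apply: (@ell1_of_blocks e (B \o Fs) Fs) => // [n|n|n|m n i|n i];
  [by case: (BP _ (fFs n))..| |]; last first.
  by case: (BP _ (fFs n)) => _ _ + _ _; apply.
elim: n => // n IH; rewrite ltnS leq_eqVlt => /predU1P[->|mn] bi; first by right.
by left; exact: IH.
Qed.

End shrinking.

(** * The gap between a functional and its modulus *)

Section bands.
Context {R : realType} {I : Type} {E : absolute_space R I}.
Context {X : I -> completeNormedModType R}.
Local Notation S := (absolute_sum E X).
Implicit Types (x y : S) (a b : E) (A B : set I).

Fact sum_restr_subproof A x i :
  `|(if `[< A i >] then cmpt x i else 0) : X i| <= entry (modulus x) i.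
Proof. by case: ifP => _; rewrite ?normr0 entry_modulus. Qed.
Definition sum_restr A x : S := solid_sum (sum_restr_subproof A x).

Lemma cmpt_restr A x i :
  cmpt (sum_restr A x) i = if `[< A i >] then cmpt x i else 0.
Proof. by []. Qed.

Lemma sum_restrC A x : x = sum_restr A x + sum_restr (~` A) x.
Proof.
apply: cmpt_inj => i; rewrite cmptD !cmpt_restr.
have [Ai|Ai] := asboolP (A i).
  by rewrite asboolF ?addr0// => /(_ Ai).
by rewrite asboolT ?add0r.
Qed.

Lemma sum_restrI A B x : sum_restr A (sum_restr B x) = sum_restr (A `&` B) x.
Proof.
apply: cmpt_inj => i; rewrite !cmpt_restr asbool_and.
by case: (`[< A i >]).
Qed.

Lemma modulus_restr A x : modulus (sum_restr A x) = restr A (modulus x).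
Proof.
apply: entry_inj => i; rewrite entry_restr !entry_modulus cmpt_restr.
by case: ifP => // _; rewrite normr0.
Qed.

(** The types of the components depend on the index, so [v] has to be transported
along the equality of the two indices. *)
Definition single_family i (v : X i) : family_prod X := fun j =>
  match pselect (i = j) with
  | left ij => eq_rect i (fun k => X k : Type) v j ij
  | right _ => 0
  end.

Lemma single_family_eq i (v : X i) : single_family v i = v.
Proof.
rewrite /single_family; case: pselect => // ii.
by rewrite (Prop_irrelevance ii erefl).
Qed.

Lemma single_family_neq i (v : X i) j : i <> j -> single_family v j = 0.
Proof. by rewrite /single_family; case: pselect. Qed.

Fact single_subproof i (v : X i) j :
  `|single_family v j| <= entry (`|v| *: as_e E i) j.
Proof.
rewrite entryZ; have [<-|ij] := pselect (i = j).
  by rewrite single_family_eq entry_e mulr1.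
by rewrite single_family_neq// normr0 mulr_ge0// nonneg_e.
Qed.
Definition single i (v : X i) : S := solid_sum (single_subproof v).

Lemma cmpt_single i (v : X i) : cmpt (single v) i = v.
Proof. exact: single_family_eq. Qed.

Lemma cmpt_single_neq i (v : X i) j : i <> j -> cmpt (single v) j = 0.
Proof. exact: single_family_neq. Qed.

Lemma single_linear i (c : R) (u v : X i) :
  single (c *: u + v) = c *: single u + single v.
Proof.
apply: cmpt_inj => j; rewrite cmptD cmptZ.
have [<-|ij] := pselect (i = j); first by rewrite !cmpt_single.
by rewrite !cmpt_single_neq// scaler0 addr0.
Qed.

Lemma singleN i (v : X i) : single (- v) = - single v.
Proof.
have inj0 : single (0 : X i) = 0.
  by have := single_linear (-1) (0 : X i) 0; rewrite scaler0 addr0 scaleN1r addNr.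
by have := single_linear (-1) v 0; rewrite inj0 !addr0 !scaleN1r.
Qed.

Lemma sum_restr1 i x : sum_restr [set i] x = single (cmpt x i).
Proof.
apply: cmpt_inj => j; rewrite cmpt_restr.
case: asboolP => [->|ji]; first by rewrite cmpt_single.
by rewrite cmpt_single_neq// => ij; exact: ji (esym ij).
Qed.

Lemma dominated_e i x : dominated x (as_e E i) ->
  x = single (cmpt x i) /\ `|cmpt x i| <= 1.
Proof.
move=> xe; split; last by rewrite -(entry_e (E := E) i); exact: xe.
rewrite -sum_restr1; apply: cmpt_inj => j; rewrite cmpt_restr.
case: asboolP => // ji; apply/normr0_eq0/le_anti.
by rewrite normr_ge0 andbT (le_trans (xe j))// entry_e_neq.
Qed.

End bands.

Lemma finite_set_induction (T : Type) (P : set T -> Prop) :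
  P set0 -> (forall A i, P A -> P (A `|` [set i])) ->
  forall A, finite_set A -> P A.
Proof.
move=> P0 PU A /finite_setP[n]; elim: n A => [|n IH] A.
  by rewrite II0 card_eq0 => /eqP ->.
move=> /eq_cardSP[x Ax /IH PA]; rewrite -(setDKU (_ : [set x] `<=` A)).
  exact: PU.
by move=> _ ->.
Qed.

Section main.
Context {R : realType} {I : Type} {E : absolute_space R I}.
Context {X : I -> completeNormedModType R}.
Local Notation S := (absolute_sum E X).
Implicit Types (x y z : S) (a b : E).

Variables (f : {linear S -> R^o}) (g : {linear E -> R^o}).
Hypothesis f_le : forall x, `|f x| <= `|x|.
Hypothesis f_g : forall x a, dominated x a -> f x <= g a.
Hypothesis g_least : forall a (t : R), nonneg a ->
  (forall x, dominated x a -> f x <= t) -> g a <= t.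

Lemma majorant_ge0 a : nonneg a -> 0 <= g a.
Proof. by move=> a0; rewrite -(linear0 f) f_g// => i; rewrite normr0; exact: a0. Qed.

Definition gap x : R := g (modulus x) - f x.

Lemma gap_ge0 x : 0 <= gap x.
Proof. by rewrite subr_ge0 f_g. Qed.

Lemma gap_le2 x : gap x <= 2 * g (modulus x).
Proof.
have : f (- x) <= g (modulus x).
  by apply: f_g => i; rewrite -[leLHS]/(`|- cmpt x i|) normrN.
by rewrite linearN /gap; lra.
Qed.

(** Additivity of the gap over complementary sets of indices reduces its study to
finitely many components and a tail. *)
Lemma gap_restrC (F : set I) x :
  gap x = gap (sum_restr F x) + gap (sum_restr (~` F) x).
Proof.
have gx : g (modulus x) =
    g (restr F (modulus x)) + g (restr (~` F) (modulus x)).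
  by rewrite -linearD -restrC.
have fx : f x = f (sum_restr F x) + f (sum_restr (~` F) x).
  by rewrite -linearD -sum_restrC.
by rewrite /gap !modulus_restr gx fx opprD addrACA.
Qed.

Lemma gap_restr (F : set I) x : gap (sum_restr F x) <= gap x.
Proof. by rewrite (gap_restrC F x) lerDl gap_ge0. Qed.

Lemma gap_restrU (F G : set I) x :
  gap (sum_restr (F `|` G) x) <= gap (sum_restr F x) + gap (sum_restr G x).
Proof.
rewrite (gap_restrC F) !sum_restrI; apply: lerD.
  by rewrite setIC setUK.
by rewrite setIUr setICl set0U -sum_restrI gap_restr.
Qed.

(* [phi] is the restriction of [f] to the i-th component, and [gam i] its norm. *)
Let gam i := g (as_e E i).
Let phi i (v : X i) : R := f (single v).

Lemma gap_single i (v : X i) : gap (single v) = gam i * `|v| - phi v.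
Proof.
rewrite /gap (_ : modulus _ = `|v| *: as_e E i) ?linearZ/= 1?mulrC//.
apply: entry_inj => j; rewrite entry_modulus entryZ.
have [<-|ij] := pselect (i = j).
  by rewrite cmpt_single entry_e mulr1.
by rewrite cmpt_single_neq// entry_e_neq ?mulr0 ?normr0// => /esym.
Qed.

Lemma phi_le i (v : X i) : `|phi v| <= gam i * `|v|.
Proof.
have h (w : X i) : phi w <= gam i * `|w|.
  by have := gap_ge0 (single w); rewrite gap_single subr_ge0.
rewrite ler_norml h andbT lerNl -(normrN v) (le_trans _ (h _))//.
by rewrite /phi singleN linearN.
Qed.

(** That [gam i] is not larger than the norm of the restriction follows from the
minimality of [g] at [e_i]: the elements dominated by [e_i] are the vectors of
the unit ball of the i-th component. *)
Lemma normalized_component_dual i : 0 < gam i ->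
  exists h : {linear X i -> R^o},
    dual_sphere h /\ forall v, h v = (gam i)^-1 * phi v.
Proof.
move=> g0; have hl : linear (fun v : X i => (gam i)^-1 * phi v : R^o).
  by move=> c u v; rewrite /phi single_linear linearP/= -![_ *: _]/(_ * _); ring.
have [h hE] := pack_linear hl; exists h; split=> //; apply/dual_sphereP; split.
  by move=> v; rewrite hE normrM gtr0_norm ?invr_gt0// ler_pdivrMl// phi_le.
move=> e e0; apply: contrapT => nv.
have : gam i <= gam i * (1 - e).
  apply: g_least => [|x xe]; first exact: nonneg_e.
  have [xE x1] := dominated_e xe; rewrite xE -/(phi _).
  rewrite -ler_pdivrMl// -hE leNgt; apply/negP => hx.
  by apply: nv; exists (cmpt x i).
by rewrite -{1}[gam i]mulr1 ler_pM2l//; lra.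
Qed.

(** [h] is [g] composed with the isometry [flip i], so it has the norm of [g]. *)
Lemma flipped_dual i : dual_sphere g -> exists h : {linear E -> R^o},
  dual_sphere h /\ forall a, h a = g a - 2 * gam i * entry a i.
Proof.
move=> /dual_sphereP[gle gex].
have hE (a : E) : g (flip i a) = g a - 2 * gam i * entry a i.
  have -> : g (flip i a) = g a - 2 * (entry a i * gam i).
    have -> : entry a i * gam i = g (restr [set i] a) by rewrite restr1 linearZ.
    by rewrite /flip linearB linearZ_LR.
  by rewrite (mulrC (entry a i)) mulrA.
have hl : linear (fun a : E => g (flip i a)).
  move=> c a b; rewrite !hE entryD entryZ linearP -![_ *: _]/(_ * _).
  by ring.
have [h hh] := pack_linear hl; exists h; split; last by move=> a; rewrite hh hE.
apply/dual_sphereP; split=> [a|e e0]; first by rewrite hh -(norm_flip i).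
have [a [a1 ga]] := gex e e0; exists (flip i a); rewrite norm_flip; split=> //.
suff -> : h (flip i a) = g a by [].
rewrite hh hE hE /flip entryD entryN entryZ entry_restr asboolT//.
by ring.
Qed.

End main.

(** * Transfer from E and the components to the sum *)

Section transfer.
Context {R : realType} {I : Type} {E : absolute_space R I}.
Context {X : I -> completeNormedModType R}.
Local Notation S := (absolute_sum E X).

Variables (A B : set S) (f : {linear S -> R^o}) (x y : nat -> S).
Hypothesis E_dense : dense (lin_span (range (@as_e R I E))).
Hypothesis E_ell1 : ~ contains_copy E (ell1 R).
Hypothesis f_dual : dual_sphere f.
Hypothesis E_pair : forall h : {linear E -> R^o}, dual_sphere h ->
  uacs_on (modulus @` A) (modulus @` B) h.
(* [E_free] is used for the pair of one of the two moduli and the halved moduli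
   of [x n + y n].  The latter need not be constant even if [x] or [y] is, so that
   only one of the two sides can be prescribed. *)
Hypothesis E_free :
  (forall h : {linear E -> R^o}, dual_sphere h ->
    uacs_on (modulus @` A) setT h) \/
  (forall h : {linear E -> R^o}, dual_sphere h ->
    uacs_on (modulus @` B) setT h).
Hypothesis X_pair : forall i (h : {linear X i -> R^o}), dual_sphere h ->
  uacs_on [set `|cmpt z i|^-1 *: cmpt z i | z in A]
          [set `|cmpt z i|^-1 *: cmpt z i | z in B] h.
Hypotheses (Ax : forall n, A (x n)) (By : forall n, B (y n)).
Hypotheses (x1 : forall n, `|x n| = 1) (y1 : forall n, `|y n| = 1).
Hypothesis xy : `|x n + y n| @[n --> \oo] --> (2 : R).
Hypothesis fx : f (x n) @[n --> \oo] --> (1 : R).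

Section majorant.
Variable g : {linear E -> R^o}.
Hypothesis f_g : forall z a, dominated z a -> f z <= g a.
Hypothesis g_dual : dual_sphere g.
Hypothesis g_least : forall (a : E) (t : R), nonneg a ->
  (forall z, dominated z a -> f z <= t) -> g a <= t.

Let g_le a : `|g a| <= `|a|. Proof. exact: dual_sphere_le. Qed.

Let gx : g (modulus (x n)) @[n --> \oo] --> (1 : R).
Proof.
apply: (@squeeze_cvgr _ _ _ _ (fun n => f (x n)) (cst 1)) => //;
  last exact: cvg_cst.
apply: nearW => n; rewrite f_g//= -(x1 n) -norm_modulus.
exact: le_trans (ler_norm _) (g_le _).
Qed.

Let mod_xy : `|modulus (x n) + modulus (y n)| @[n --> \oo] --> (2 : R).
Proof.
apply: (@squeeze_cvgr _ _ _ _ (fun n => `|x n + y n|) (cst 2)) => //;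
  last exact: cvg_cst.
apply: nearW => n; apply/andP; split.
  rewrite -norm_modulus; apply: norm_le_entry => i.
  rewrite entryD !entry_modulus cmptD normr_id ger0_norm ?addr_ge0//.
  exact: ler_normD.
by rewrite (le_trans (ler_normD _ _))// !norm_modulus x1 y1.
Qed.

Let gy : g (modulus (y n)) @[n --> \oo] --> (1 : R).
Proof.
apply: (uacs_on_cvg (E_pair g_dual) g_le _ _ _ _ mod_xy gx) => [n|n|n|].
- by exists (x n).
- by rewrite norm_modulus y1 invr1 scale1r; exists (y n).
- by rewrite norm_modulus.
- by under eq_cvg do rewrite norm_modulus y1; exact: cvg_cst.
Qed.

Let w n : E := 2^-1 *: modulus (x n + y n).

Let norm_w : `|w n| @[n --> \oo] --> (1 : R).
Proof.
have -> : (1 : R) = 2^-1 * 2 by rewrite mulVf.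
under eq_cvg do rewrite /w normrZ norm_modulus ger0_norm//.
exact: cvgMl_tmp.
Qed.

(* Here [u] is one of the two sequences, and [v] the other one.  The bound is that
   of [u + (x + y) / 2 = 3/2 (x + y) - v], whose norm is at least
   [3/2 |x + y| - 1]. *)
Let mod_w (u v : nat -> S) : (forall n, `|u n| = 1) -> (forall n, `|v n| = 1) ->
  (forall n, u n + v n = x n + y n) ->
  `|modulus (u n) + w n| @[n --> \oo] --> (2 : R).
Proof.
move=> u1 v1 uv.
apply: (@squeeze_cvgr _ _ _ _ (fun n => 3 / 2 * `|x n + y n| - 1) (cst 2)) => //.
- apply: nearW => n; apply/andP; split.
    have h : `|u n + 2^-1 *: (x n + y n)| <= `|modulus (u n) + w n|.
      rewrite -norm_modulus; apply: norm_le_entry => i.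
      rewrite entryD entryZ !entry_modulus cmptD cmptZ normr_id.
      rewrite ger0_norm ?addr_ge0// ?mulr_ge0// (le_trans (ler_normD _ _))//.
      by rewrite normrZ ger0_norm.
    apply: le_trans h; rewrite lerBlDr -[X in _ <= _ + X](v1 n).
    rewrite -[3 / 2]ger0_norm ?divr_ge0// -normrZ (le_trans _ (ler_normD _ _))//.
    rewrite addrAC uv -{2}[x n + y n]scale1r -scalerDl le_eqVlt; apply/orP; left.
    by apply/eqP; congr (`|_ *: _|); field.
  rewrite (le_trans (ler_normD _ _))// norm_modulus u1 /w normrZ norm_modulus.
  have := ler_normD (x n) (y n); rewrite x1 y1 ger0_norm//=; lra.
- rewrite [X in _ --> X](_ : _ = 3 / 2 * 2 - 1); last by field.
  have c1 : 3 / 2 * `|x n + y n| @[n --> \oo] --> (3 / 2 * 2 : R).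
    exact: cvgMl_tmp.
  by apply: cvgB c1 _; exact: cvg_cst.
- exact: cvg_cst.
Qed.

Let gw : g (w n) @[n --> \oo] --> (1 : R).
Proof.
case: E_free => /(_ _ g_dual) Ew.
- apply: (uacs_on_cvg Ew g_le _ _ _ norm_w (mod_w x1 y1 _) gx) => // n.
  by exists (x n).
- apply: (uacs_on_cvg Ew g_le _ _ _ norm_w (mod_w y1 x1 _) gy) => // n.
  + by exists (y n).
  + exact: addrC.
Qed.

(* [D n] is the coordinatewise defect in the triangle inequality; as it is
   positive, smallness of [g (D n)] controls it at each [i] with [g e_i > 0]. *)
Let D n : E := modulus (x n) + modulus (y n) - modulus (x n + y n).

Let D_nonneg n : nonneg (D n).
Proof.
move=> i; rewrite /D entryD entryN entryD !entry_modulus cmptD subr_ge0.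
exact: ler_normD.
Qed.

Let gD : g (D n) @[n --> \oo] --> (0 : R).
Proof.
have DE n : g (D n) = g (modulus (x n)) + g (modulus (y n)) - 2 * g (w n).
  have -> : 2 * g (w n) = g (modulus (x n + y n)).
    by rewrite /w linearZ_LR -[_ *: _]/(_ * _) mulrA mulfV ?mul1r.
  by rewrite /D linearB linearD.
rewrite (funext DE) (_ : (0 : R) = 1 + 1 - 2 * 1); last by ring.
have c2 : 2 * g (w n) @[n --> \oo] --> (2 * 1 : R) by exact: cvgMl_tmp.
exact: cvgB (cvgD gx gy) c2.
Qed.

Let gap_x : gap f g (x n) @[n --> \oo] --> (0 : R).
Proof. by rewrite -(subrr (1 : R)); exact: cvgB. Qed.

Let gam_entry_le (a : E) i : nonneg a -> g (as_e E i) * entry a i <= g a.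
Proof.
move=> a0; rewrite {2}(restrC [set i] a) linearD restr1 linearZ_LR mulrC.
by rewrite lerDl (majorant_ge0 f_g)//; exact: nonneg_restr.
Qed.

(* With [c = g e_i], the sign-flipped functional takes the value
   [g |x n| - 2 c |x n i|] at the modulus of [x n], hence the bound [d / (4 c)]. *)
Let small_entry i (e : R) : 0 < g (as_e E i) -> 0 < e ->
  exists2 r : R, 0 < r &
    \forall n \near \oo, `|cmpt (x n) i| < r -> `|cmpt (y n) i| < e.
Proof.
set c := g _ => c0 e0.
have [h [h_dual hE]] := flipped_dual i g_dual.
have ce : 0 < 2 * c * e by rewrite !mulr_gt0.
have [d d0 Hd] := E_pair h_dual ce.
exists (d / (4 * c)); first by rewrite divr_gt0// mulr_gt0.
have d2 : 0 < d / 2 by rewrite divr_gt0.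
near=> n.
have n1 : `|2 - `|modulus (x n) + modulus (y n)| | < d.
  by near: n; move/cvgrPdist_lt : mod_xy; apply.
have n2 : `|1 - g (modulus (x n))| < d / 2.
  by near: n; move/cvgrPdist_lt : gx; apply.
rewrite ltr_pdivlMr ?mulr_gt0// => xr.
have := Hd (modulus (x n)) (modulus (y n)).
rewrite !hE !norm_modulus !entry_modulus -/c => H.
have gy1 : g (modulus (y n)) <= 1.
  by rewrite -(y1 n) -norm_modulus; exact: le_trans (ler_norm _) (g_le _).
suff : 2 * c * `|cmpt (y n) i| < 2 * c * e by rewrite ltr_pM2l// mulr_gt0.
have : 1 - 2 * c * e < g (modulus (y n)) - 2 * c * `|cmpt (y n) i|.
  apply: H => //; [by exists (x n)|by exists (y n)| |].
    by move: n1; rewrite ltr_norml => /andP[_]; lra.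
  by move: n2; rewrite ltr_norml => /andP[_]; lra.
lra.
Unshelve. all: by end_near. Qed.

Let gap_y1 i : gap f g (sum_restr [set i] (y n)) @[n --> \oo] --> (0 : R).
Proof.
have gapE : (fun n => gap f g (sum_restr [set i] (y n))) =
    (fun n => g (as_e E i) * `|cmpt (y n) i| - f (single (cmpt (y n) i))).
  by apply/funext => n; rewrite sum_restr1 gap_single.
have : 0 <= g (as_e E i) by apply: (majorant_ge0 f_g); exact: nonneg_e.
rewrite le_eqVlt => /predU1P[c0|c0].
  have gap0 : (fun n => gap f g (sum_restr [set i] (y n))) = cst 0.
    rewrite gapE; apply/funext => n; have := phi_le f_g (cmpt (y n) i).
    by rewrite -c0 !mul0r normr_le0 => /eqP ->; rewrite subr0.
  by rewrite gap0; exact: cvg_cst.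
have [h [h_dual hE]] := normalized_component_dual f_g g_least c0.
set c := g (as_e E i) in c0 hE *.
suff cy : `|cmpt (y n) i| - h (cmpt (y n) i) @[n --> \oo] --> (0 : R).
  rewrite gapE -(mulr0 c).
  rewrite [X in X @ _](_ : _ =
      (fun n => c * (`|cmpt (y n) i| - h (cmpt (y n) i)))).
    exact: cvgMl_tmp.
  by apply/funext => n; rewrite hE mulrBr mulrA mulfV ?mul1r// gt_eqF.
apply: (uacs_on_rescaled (u := fun n => cmpt (x n) i) (X_pair h_dual)).
- by move=> z; exact: dual_sphere_le.
- by move=> n; exists (x n).
- by move=> n; exists (y n).
- move=> n; rewrite -(y1 n) -norm_modulus -[leLHS]normr_id.
  exact: (entry_le_norm (modulus (y n)) i).
- by move=> e e0; exact: small_entry.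
- apply: (@squeeze_cvgr _ _ _ _ (cst 0) (fun n => c^-1 * g (D n))).
  + apply: nearW => n; rewrite -cmptD.
    have -> : `|cmpt (x n) i| + `|cmpt (y n) i| - `|cmpt (x n + y n) i| =
        entry (D n) i.
      by rewrite /D entryD entryN entryD !entry_modulus.
    by rewrite D_nonneg/= ler_pdivlMl//; exact: (gam_entry_le i (D_nonneg n)).
  + exact: cvg_cst.
  + by rewrite -(mulr0 c^-1); exact: cvgMl_tmp.
- apply: (@squeeze_cvgr _ _ _ _ (cst 0) (fun n => c^-1 * gap f g (x n))).
  + apply: nearW => n; rewrite subr_ge0.
    rewrite (le_trans (ler_norm _)) ?dual_sphere_le//= ler_pdivlMl//.
    rewrite hE mulrBr mulrA mulfV ?gt_eqF// mul1r -gap_single -sum_restr1.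
    exact: gap_restr.
  + exact: cvg_cst.
  + by rewrite -(mulr0 c^-1); exact: cvgMl_tmp.
Qed.

Let gap_yF (F : set I) : finite_set F ->
  gap f g (sum_restr F (y n)) @[n --> \oo] --> (0 : R).
Proof.
move: F; apply: finite_set_induction => [|F i cF].
  have -> : (fun n => gap f g (sum_restr set0 (y n))) = cst 0.
    apply/funext => n; rewrite (_ : sum_restr _ _ = 0); last first.
      by apply: cmpt_inj => i; rewrite cmpt_restr asboolF.
    by rewrite /gap modulus0 !linear0 addr0.
  exact: cvg_cst.
apply: (@squeeze_cvgr _ _ _ _ (cst 0) (fun n =>
    gap f g (sum_restr F (y n)) + gap f g (sum_restr [set i] (y n)))).
- by apply: nearW => n; rewrite gap_ge0//= gap_restrU.
- exact: cvg_cst.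
- by rewrite -(addr0 (0 : R)); apply: cvgD => //; exact: gap_y1.
Qed.

Let gap_y : gap f g (y n) @[n --> \oo] --> (0 : R).
Proof.
apply/cvgr0Pnorm_lt => e e0.
have e4 : 0 < e / 4 by rewrite divr_gt0.
have e2 : 0 < e / 2 by rewrite divr_gt0.
have [F fF tail] := shrinking_functional g_le E_dense E_ell1 e4.
near=> n.
have n1 : `|gap f g (sum_restr F (y n))| < e / 2.
  by near: n; move/cvgr0Pnorm_lt : (gap_yF fF); apply.
rewrite ger0_norm ?gap_ge0// (gap_restrC f g F).
have t1 : g (modulus (sum_restr (~` F) (y n))) <= e / 4.
  rewrite modulus_restr; apply: tail => [||i Fi].
  - exact: nonneg_restr (nonneg_modulus _).
  - by rewrite (le_trans (norm_restr _ _))// norm_modulus y1.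
  - by rewrite entry_restr asboolF// => /(_ Fi).
have := gap_le2 f_g (sum_restr (~` F) (y n)).
by move: n1; rewrite ltr_norml => /andP[_]; lra.
Unshelve. all: by end_near. Qed.

Lemma majorant_transfer : f (y n) @[n --> \oo] --> (1 : R).
Proof.
rewrite (_ : (fun n => _) = (fun n => g (modulus (y n)) - gap f g (y n))).
  by rewrite -(subr0 (1 : R)); exact: cvgB.
by apply/funext => n; rewrite /gap opprB addrC subrK.
Qed.

End majorant.

Lemma uacs_on_transfer : f (y n) @[n --> \oo] --> (1 : R).
Proof.
have [f_le f_ex] := (dual_sphereP f).1 f_dual.
have [g [g_le f_g g_least]] := modulus_functional f_le.
apply: (majorant_transfer f_g) => //; apply/dual_sphereP; split=> // e e0.
have [z [z1 fz]] := f_ex e e0; exists (modulus z); split=> //.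
exact: lt_le_trans fz (f_g _ _ (dominated_modulus z)).
Qed.

End transfer.

Theorem proposition3p9 (R : realType) (I : Type) (I_nonempty : inhabited I)
    (E : absolute_space R I) (X : I -> completeNormedModType R) :
  dense (lin_span (range (@as_e R I E))) ->
  ~ contains_copy E (ell1 R) ->
  ((forall i : I, wuacs (X i)) -> wuacs E -> wuacs (absolute_sum E X)) /\
  ((forall i : I, luacs_plus (X i)) -> luacs_plus E ->
     luacs_plus (absolute_sum E X)).
Proof.
move=> dE nE; split=> [wX wE x y f x1 y1 df xy fx|lX lE x xn f x1 xn1 xnx df].
  apply: (@uacs_on_transfer _ _ _ _ setT setT f x y dE nE df) => //.
  - by move=> h dh; apply: (uacs_on_sub (wuacs_uacs_on wE dh)).
  - by left=> h dh; apply: (uacs_on_sub (wuacs_uacs_on wE dh)).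
  - by move=> i h dh; apply: (uacs_on_sub (wuacs_uacs_on (wX i) dh)).
have lEl (h : {linear E -> R^o}) (z : absolute_sum E X) : dual_sphere h ->
    uacs_on (modulus @` [set z]) setT h.
  by move=> dh; rewrite image_set1; exact: luacs_uacs_onl.
have lEr (h : {linear E -> R^o}) (z : absolute_sum E X) : dual_sphere h ->
    uacs_on setT (modulus @` [set z]) h.
  by move=> dh; rewrite image_set1; exact: luacs_uacs_onr.
split=> [fxn|fx1].
  have H : f (cst x n) @[n --> \oo] --> (1 : R).
    apply: (@uacs_on_transfer _ _ _ _ setT [set x] f xn (cst x) dE nE df) => //.
    - by move=> h dh; apply: (uacs_on_sub (lEr h x dh)).
    - by right=> h dh; exact: lEl.
    - move=> i h dh; rewrite image_set1.
      exact: (uacs_on_sub (luacs_uacs_onr _ (lX i) dh) (@subsetT _ _)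
        (@subset_refl _ _)).
  exact: (cvg_unique (@norm_hausdorff _ R^o) (@cvg_cst _ (f x) _ \oo _) H).
apply: (@uacs_on_transfer _ _ _ _ [set x] setT f (cst x) xn dE nE df) => //.
- by move=> h dh; apply: (uacs_on_sub (lEl h x dh)).
- by left=> h dh; exact: lEl.
- move=> i h dh; rewrite image_set1.
  exact: (uacs_on_sub (luacs_uacs_onl _ (lX i) dh) (@subset_refl _ _)
    (@subsetT _ _)).
- by under eq_cvg do rewrite addrC.
- rewrite (_ : (fun n => f (cst x n)) = cst 1); first exact: cvg_cst.
  by apply/funext => n; exact: fx1.
Qed.
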